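(* The set of positive integers $n$ for which there is no inseparable cubic graph with exactly $n$ cycles is $\{1, 2, 4, 5, 8, 9, 13, 16\}$. Moreover, the set of positive integers $n$ for which there is no inseparable planar cubic graph with exactly $n$ cycles is also $\{1, 2, 4, 5, 8, 9, 13, 16\}$.
   Context: Graphs are finite; multiple (parallel) edges are allowed but loops are not. A graph is cubic if every vertex has degree 3 (parallel edges counted with multiplicity). A cycle is a connected 2-regular subgraph; in particular two parallel edges with their common endpoints form a cycle of length 2. Cycles are counted as subgraphs (equivalently, as edge sets). A graph is inseparable if it is connected and has no cutpoint (cut vertex); for loop-free graphs with more than two vertices this is the same as 2-connectivity. *)

(* Defs.v *)
From mathcomp Require Import all_boot all_order all_algebra.
From mathcomp Require Import all_classical all_reals all_analysis.
Set Implicit Arguments.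
Unset Strict Implicit.
Unset Printing Implicit Defensive.
Import Order.TTheory GRing.Theory Num.Theory numFieldNormedType.Exports.

(* Distinct edges may have the same ends (parallel edges); an edge has two
   distinct ends, so there are no loops. *)
Record mgraph := MGraph {
  vertex : finType;
  edge : finType;
  ends : edge -> {set vertex};
  card_ends : forall e, #|ends e| = 2 }.

Section Graph.
Variable G : mgraph.

(* A vertex set and an edge set; see is_subgraph for the condition that the
   edges have their ends among the vertices. *)
Definition vepair : finType := ({set vertex G} * {set edge G})%type.

Implicit Types (H : vepair) (v : vertex G).

Definition is_subgraph H : bool := [forall e in H.2, ends e \subset H.1].

Definition whole : vepair := ([set: vertex G]%SET, [set: edge G]%SET).

Definition del_vertex v : vepair :=
  (~: [set v]%SET, [set e : edge G | v \notin ends e]%SET).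

Definition degree H v : nat := #|[set e in H.2 | v \in ends e]%SET|.

Definition adj H : rel (vertex G) :=
  fun u v => [exists e in H.2, ends e == [set u; v]%SET].

Definition components H : nat := n_comp (adj H) (mem H.1).

(* In particular the empty graph, with no component, is not connected. *)
Definition is_connected H : bool := components H == 1.

Definition is_cycle H : bool :=
  [&& is_subgraph H, is_connected H & [forall v in H.1, degree H v == 2]].

Definition ncycles : nat := #|[set H | is_cycle H]%SET|.

Definition cubic : bool := [forall v, degree whole v == 3].

Definition cutpoint v : bool := components whole < components (del_vertex v).

Definition inseparable : bool :=
  is_connected whole && [forall v, ~~ cutpoint v].

End Graph.

Local Open Scope ring_scope.
Local Open Scope classical_set_scope.

(* The graph has a drawing in the plane: distinct points for the vertices and,
   for each edge, a simple arc joining its ends, no two of these arcs crossing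
   and none passing through a vertex. *)
Definition planar (R : realType) (G : mgraph) : Prop :=
  exists (p : vertex G -> R * R) (c : edge G -> R -> R * R),
    [/\ injective p,
        forall e, {within `[0, 1], continuous (c e)} /\
                  {in `[0, 1]%R &, injective (c e)},
        forall e, exists u v,
          [/\ ends e = [set u; v]%SET, c e 0 = p u & c e 1 = p v],
        forall e v t, 0 < t < 1 -> c e t <> p v &
        forall e f s t, e != f -> 0 < s < 1 -> 0 < t < 1 ->
          c e s <> c f t].

(* Main.v *)
Require Import Defs.
From mathcomp Require Import all_boot zify.
Set Implicit Arguments.
Unset Strict Implicit.
Unset Printing Implicit Defensive.
Local Open Scope set_scope.

(** A cubic graph has degree at most 3 everywhere, so its cycles are the minimal
nonempty edge sets with all degrees even: the circuits of its cycle space Z over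
the field with two elements ([ncycles_circuits]).  If it has a vertex, it is inseparable
exactly when any two edges lie on a common circuit ([inseparable_linked],
[linked_inseparable]).  Everything below is done with circuits.

No graph for the eight exceptions.  Circuits through an edge e of a linked
space span it, so if it has 2^r elements there are at least r of them.  A linked
set of edges can be enlarged by an ear so that the space of even sets inside it
exactly doubles; all new circuits contain the ear, so at least 1 + 2 + ... + r
circuits appear in all ([linked_lower_bound]).  With 2k vertices r is at least
k + 1, hence there are at least 3, 6, 10, 15, 21 cycles for 2, 4, 6, 8, 10
vertices.  As 21 exceeds 16, at most eight vertices remain.  There are few
connected cubic graphs of that size up to relabelling: they are enumerated with
their vertices in breadth-first order ([explore_complete], [coded_explore]), and
the computed numbers of circuits leave out the remaining cases
([explore_small], [ncycles_neq]).

A planar graph for every other n.  Let e be an edge of a graph with a circuits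
avoiding e and p circuits through e.  Cut e and an edge f of a second graph, and
join the loose ends crosswise: an even set of the result is a pair of even sets
that agree on containing e and f, so its circuits can be counted
([card_circuits_two_sum]).  Two choices of the second graph turn (a, p) into
(a + p, p + 1) and (a + 6p + 4, p + 6).  Call C(p, 2) - a the deficit.  The first
move keeps it and the second adds 11 to it, so a start with deficit d and p0
circuits through e reaches every n = C(p + 1, 2) - d - 11t with p >= p0 + 6t
([attained_family]).  The list [rows] has starts of every residue of d modulo 11,
which settles all large n: moving p by one moves n by about p, the deficits
needed fill an interval of length p, and 11t costs only 6t ([cover_large]).  A
finite search settles the others ([search_small]).

Planarity is carried along as a two-page layout: the vertices lie on a line, the
edges are arcs above or below it, and e spans everything from above.  The second
graph swallows the first at one end of f ([sum_noncrossing]).  As arcs one takes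
the parabolas y = (x - a)(b - x) and their reflections; of two that have
overlapping spans and are nested, the outer one is strictly above the inner one
([noncrossing_planar]). *)

(** * Circuits of a binary space *)

Section SymDiff.
Variable T : finType.
Implicit Types (X Y : {set T}) (x : T).
(** Addition in the space of subsets over the field with two elements. *)
Definition symd X Y : {set T} := [set x | (x \in X) (+) (x \in Y)].

Lemma in_symd X Y x : (x \in symd X Y) = (x \in X) (+) (x \in Y).
Proof. by rewrite inE. Qed.

Lemma symdC X Y : symd X Y = symd Y X.
Proof. by apply/setP=> x; rewrite !inE addbC. Qed.

Lemma symdA X Y W : symd X (symd Y W) = symd (symd X Y) W.
Proof. by apply/setP=> x; rewrite !inE addbA. Qed.

Lemma symd0 X : symd X set0 = X.
Proof. by apply/setP=> x; rewrite !inE addbF. Qed.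

Lemma symdK X Y : symd X (symd X Y) = Y.
Proof. by apply/setP=> x; rewrite !inE addKb. Qed.

(** All sums of subfamilies of [l], listed with repetitions, so that the size is
known without any linear independence. *)
Fixpoint span (l : seq {set T}) : seq {set T} :=
  if l is C :: l' then span l' ++ [seq symd C X | X <- span l'] else [:: set0].

Lemma size_span l : size (span l) = 2 ^ size l.
Proof. by elim: l => //= C l IH; rewrite size_cat size_map IH addnn -mul2n expnS. Qed.

Lemma mem_span_tail C l X : X \in span l -> X \in span (C :: l).
Proof. by move=> Xl; rewrite mem_cat Xl. Qed.

Lemma span0 l : set0 \in span l.
Proof. by elim: l => [|C l IH]; rewrite ?mem_seq1 // mem_span_tail. Qed.

Lemma mem_span l C : C \in l -> C \in span l.
Proof.
elim: l => //= D l IH; rewrite inE mem_cat => /orP[/eqP->|/IH->//].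
by apply/orP; right; apply/mapP; exists set0; rewrite ?span0 ?symd0.
Qed.

Lemma symd_span l X Y : X \in span l -> Y \in span l -> symd X Y \in span l.
Proof.
elim: l X Y => [|C l IH] X Y.
  by rewrite !mem_seq1 => /eqP-> /eqP->; rewrite symd0.
rewrite /= !mem_cat => /orP[Xl|/mapP[X' Xl ->]] /orP[Yl|/mapP[Y' Yl ->]].
- by rewrite IH.
- by rewrite symdA (symdC X) -symdA map_f ?orbT // IH.
- by rewrite -symdA map_f ?orbT // IH.
- by rewrite -symdA (symdC X') -symdA symdK symdC IH.
Qed.

End SymDiff.

Section Circuits.
Variables (T : finType) (Z : {set {set T}}).

Definition circuit (C : {set T}) : bool :=
  [&& C \in Z, C != set0 & [forall X in Z, (X \subset C) ==> (X != set0) ==> (X == C)]].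

Lemma circuitP C :
  reflect [/\ C \in Z, C != set0 &
             forall X, X \in Z -> X \subset C -> X != set0 -> X = C]
          (circuit C).
Proof.
apply: (iffP and3P) => [[CZ C0 /forall_inP minC]|[CZ C0 minC]]; split=> //.
  by move=> X XZ XC X0; apply/eqP; move: (minC X XZ); rewrite XC X0.
by apply/forall_inP=> X XZ; apply/implyP=> XC; apply/implyP=> X0; rewrite (minC X).
Qed.

Definition joined (S : {set T}) (e f : T) :=
  exists C, [/\ circuit C, C \subset S, e \in C & f \in C].

Definition linked (S : {set T}) := forall e f, e \in S -> f \in S -> joined S e f.

Hypothesis Z0 : set0 \in Z.
Hypothesis ZD : forall X Y, X \in Z -> Y \in Z -> symd X Y \in Z.

(** A minimal even subset of [X] containing [e] is minimal outright: a smaller even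
set missing [e] could be subtracted from it. *)
Lemma circuit_sub X e : X \in Z -> e \in X ->
  exists C, [/\ circuit C, C \subset X & e \in C].
Proof.
move=> XZ eX; pose P Y := [&& Y \in Z, e \in Y & Y \subset X].
have PX : P X by rewrite /P XZ eX subxx.
have [C /minsetP[/and3P[CZ eC CX] minC] _] := minset_exists PX.
exists C; split=> //; apply/circuitP; split=> //; first by apply/set0Pn; exists e.
move=> Y YZ YC Y0; case eY: (e \in Y).
  by apply: minC => //; rewrite /P YZ eY (subset_trans YC CX).
have CY x : (x \in symd C Y) = (x \in C) && (x \notin Y).
  by rewrite in_symd; move: (subsetP YC x); case: (x \in C); case: (x \in Y) => // /(_ isT).
have sCY : symd C Y \subset C by apply/subsetP=> x; rewrite CY => /andP[].
have /minC/(_ sCY)/setP eqCY : P (symd C Y).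
  by rewrite /P ZD //= CY eC eY (subset_trans sCY CX).
have [y yY] := set0Pn _ Y0.
by move: (eqCY y); rewrite CY yY (subsetP YC y yY).
Qed.

Lemma circuit_proper C X : circuit C -> X \in Z -> X \subset C ->
  forall y, y \in C -> y \notin X -> X = set0.
Proof.
move=> /circuitP[_ _ minC] XZ XC y yC yX; apply/eqP/negPn/negP=> X0.
by move: yX; rewrite (minC X) // yC.
Qed.

(** What [D1] leaves of [C + D] is an even set inside [D :\: C], a proper subset of
the circuit [D], hence empty. *)
Lemma symd_remainder C D D1 :
  C \in Z -> circuit D -> D1 \in Z -> D1 \subset symd C D ->
  C :\: D \subset D1 -> (exists2 y, y \in C & y \in D) -> D1 = symd C D.
Proof.
move=> CZ Dc D1Z D1X CD [y yC yD]; have [DZ _ _] := circuitP _ Dc.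
have XD x : (x \in symd (symd C D) D1) = [&& x \in D, x \notin C & x \notin D1].
  rewrite !in_symd; move: (subsetP D1X x) (subsetP CD x); rewrite in_symd !inE.
  by case: (x \in C); case: (x \in D); case: (x \in D1) => //= h1 h2;
     case: notF; auto.
suff /setP eq0 : symd (symd C D) D1 = set0.
  apply/setP=> x; move: (eq0 x); rewrite in_symd in_set0.
  by case: (x \in D1); case: (x \in symd C D).
apply: (circuit_proper Dc _ _ yD); first by rewrite !ZD.
  by apply/subsetP=> x; rewrite XD => /andP[].
by rewrite XD yD yC.
Qed.

(** Otherwise [D1] would be a proper nonempty even subset of the circuit [C]. *)
Lemma symd_meets C D D1 e :
  circuit C -> circuit D1 -> D1 \subset symd C D -> e \in D1 -> e \in C ->
  (exists2 y, y \in C & y \in D) -> exists2 y, y \in D1 & y \in D.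
Proof.
move=> Cc D1c D1X eD1 eC [y yC yD].
have [D1Z D10 _] := circuitP _ D1c.
case: (pickP (mem (D1 :&: D))) => [z /setIP[zD1 zD]|none]; first by exists z.
suff D1E : D1 = set0 by rewrite D1E eqxx in D10.
apply: (circuit_proper Cc D1Z _ yC).
  apply/subsetP=> x xD1; have := none x; rewrite !inE xD1 /= => xD.
  by have := subsetP D1X x xD1; rewrite in_symd xD addbF.
by apply/negP=> yD1; have := subsetP D1X y yD1; rewrite in_symd yC yD.
Qed.

Lemma joined_sym S e f : joined S e f -> joined S f e.
Proof. by case=> C [? ? ? ?]; exists C. Qed.

(** Among the pairs of a circuit through [e] and an intersecting circuit through [f],
take one with the smallest union.  If neither contains both edges, the circuit
through [e] in their sum is another such choice, so by minimality it covers the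
part of the first circuit outside the second, and then it is the whole sum. *)
Lemma joined_trans S e x f : joined S e x -> joined S x f -> joined S e f.
Proof.
move=> [C0 [C0c C0S eC0 xC0]] [D0 [D0c D0S xD0 fD0]].
pose P (p : {set T} * {set T}) :=
  [&& circuit p.1, p.1 \subset S, e \in p.1, circuit p.2, p.2 \subset S,
      f \in p.2 & p.1 :&: p.2 != set0].
have P0 : P (C0, D0).
  rewrite /P /= C0c C0S eC0 D0c D0S fD0; apply/set0Pn.
  by exists x; rewrite inE xC0 xD0.
case: (arg_minnP (fun p => #|p.1 :|: p.2|) P0) => [[C D] /=].
case/and5P=> /= Cc CS eC Dc /and3P[DS fD /set0Pn[y /setIP[yC yD]]] minCD.
case eD: (e \in D); first by exists D.
case fC: (f \in C); first by exists C.
have [CZ _ _] := circuitP _ Cc; have [DZ _ _] := circuitP _ Dc.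
have XU : symd C D \subset C :|: D.
  by apply/subsetP=> z; rewrite in_symd inE; case: (z \in C); case: (z \in D).
have [|D1 [D1c D1X eD1]] := @circuit_sub (symd C D) e (ZD CZ DZ).
  by rewrite in_symd eC eD.
have [D1Z _ _] := circuitP _ D1c.
have D1S : D1 \subset S.
  by rewrite (subset_trans D1X) // (subset_trans XU) // subUset CS.
have [||||||z zD1 zD] := @symd_meets C D D1 e => //; first by exists y.
exists D1; split=> //.
rewrite (@symd_remainder C D D1) ?in_symd ?fD ?fC //; last by exists y.
have sub1 : D1 :|: D \subset C :|: D.
  by rewrite subUset subsetUr (subset_trans D1X XU).
have /minCD : P (D1, D).
  by rewrite /P /= D1c D1S eD1 Dc DS fD; apply/set0Pn; exists z; rewrite inE zD1 zD.
rewrite /= => leU; have /eqP/setP eqU : D1 :|: D == C :|: D by rewrite eqEcard sub1.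
apply/subsetP=> w /setDP[wC wD]; have := eqU w.
by rewrite !inE wC (negPf wD) orbF.
Qed.

Definition within (S : {set T}) := [set X in Z | X \subset S].

Lemma symd_within S X Y : X \in within S -> Y \in within S -> symd X Y \in within S.
Proof.
rewrite !inE => /andP[XZ /subsetP XS] /andP[YZ /subsetP YS]; rewrite ZD //=.
apply/subsetP=> x; rewrite in_symd; move: (XS x) (YS x).
by case: (x \in X); case: (x \in Y) => //= [-> | _ ->].
Qed.

(** Every even set is a disjoint union of circuits. *)
Lemma within_ind (S : {set T}) (P : {set T} -> Prop) :
  P set0 -> (forall C X, circuit C -> C \subset S -> P X -> P (symd C X)) ->
  forall X, X \in within S -> P X.
Proof.
move=> P0 PS X; have [n] := ubnP #|X|; elim: n X => // n IH X leX XS.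
have [->//|/set0Pn[x xX]] := eqVneq X set0.
have := XS; rewrite inE => /andP[XZ XsubS].
have [C [Cc CX xC]] := circuit_sub XZ xX; have [CZ C0 _] := circuitP _ Cc.
have CS : C \subset S := subset_trans CX XsubS.
rewrite -(symdK C X); apply: PS => //; apply: IH; last first.
  by rewrite symd_within // inE CZ CS.
rewrite ltnS in leX; apply: leq_trans leX; apply: (@leq_ltn_trans #|X :\ x|).
  apply/subset_leq_card/subsetP=> y; rewrite in_symd !inE.
  have := subsetP CX y; case: eqP => [->|_ /=]; first by rewrite xC xX.
  by case: (y \in C) => //= ->.
by rewrite (cardsD1 x X) xX.
Qed.

Definition through (S : {set T}) e := [set C | [&& circuit C, C \subset S & e \in C]].

(** For a circuit [C] that avoids [e], take a circuit [D] through [e] that meets [C] and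
has the least part outside [C].  Then [C + D] is a circuit through [e] as well, and
[C] is the sum of the two. *)
Lemma through_span (S : {set T}) e X : linked S -> e \in S ->
  X \in within S -> X \in span (enum (through S e)).
Proof.
move=> lS eS; move: X; apply: within_ind; first exact: span0.
move=> C X Cc CS IH; apply: symd_span => //.
have mem D : circuit D -> D \subset S -> e \in D -> D \in span (enum (through S e)).
  by move=> Dc DS eD; rewrite mem_span // mem_enum inE Dc DS.
have [CZ C0 _] := circuitP _ Cc; have [x xC] := set0Pn _ C0.
case eC: (e \in C); first exact: mem.
have [D0 [D0c D0S eD0 xD0]] := lS _ _ eS (subsetP CS x xC).
pose P D := [&& D \in through S e & C :&: D != set0].
have P0 : P D0.
  by rewrite /P !inE D0c D0S eD0 /=; apply/set0Pn; exists x; rewrite inE xC.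
case: (arg_minnP (fun D => #|D :\: C|) P0) => D /andP[].
rewrite inE => /and3P[Dc DS eD] /set0Pn[y /setIP[yC yD]] minD.
have [DZ _ _] := circuitP _ Dc.
have XS : symd D C \subset S.
  apply/subsetP=> z; rewrite in_symd; move: (subsetP DS z) (subsetP CS z).
  by case: (z \in D); case: (z \in C) => //= [-> | _ ->].
have [|D1 [D1c D1X eD1]] := @circuit_sub (symd D C) e (ZD DZ CZ).
  by rewrite in_symd eC eD.
have [D1Z _ _] := circuitP _ D1c.
have [||||||z zD1 zC] := @symd_meets D C D1 e => //; first by exists y.
have D1E : D1 = symd D C.
  apply: symd_remainder => //; last by exists y.
  have sub1 : D1 :\: C \subset D :\: C.
    apply/subsetP=> w /setDP[wD1 wC]; have := subsetP D1X w wD1.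
    by rewrite in_symd !inE (negPf wC) addbF => ->.
  have /minD leD : P D1.
    rewrite /P !inE D1c eD1 (subset_trans D1X XS) /=.
    by apply/set0Pn; exists z; rewrite inE zC.
  have /eqP/setP eqD : D1 :\: C == D :\: C by rewrite eqEcard sub1.
  by apply/subsetP=> w wD; have := eqD w; rewrite wD inE => /andP[].
rewrite -(symdK D C) -D1E symd_span //; apply: mem => //.
exact: subset_trans D1X XS.
Qed.

Lemma card_within_le (S : {set T}) e : linked S -> e \in S -> #|within S| <= 2 ^ #|through S e|.
Proof.
move=> lS eS; rewrite !cardE -size_span; apply: uniq_leq_size; first exact: enum_uniq.
by move=> X; rewrite mem_enum; apply: through_span.
Qed.

(** The ear is [D :\: S], for a circuit [D] that meets [S] and leaves it with the
fewest elements outside.  An even set inside [S :|: D] contains all of the ear or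
none of it, so adding [D] exchanges the two kinds. *)
Lemma linked_grow (S : {set T}) x : linked [set: T] -> linked S -> S != set0 -> x \notin S ->
  exists S' f, [/\ linked S', S \subset S', f \in S', f \notin S &
     #|within S'| = 2 * #|within S| ].
Proof.
move=> lT lS /set0Pn[s sS] xS.
have [D0 [D0c _ sD0 xD0]] := lT s x (in_setT _) (in_setT _).
pose P D := [&& circuit D, S :&: D != set0 & ~~ (D \subset S)].
have P0 : P D0.
  rewrite /P D0c /=; apply/andP; split; first by apply/set0Pn; exists s; rewrite inE sS.
  by apply/subsetPn; exists x.
case: (arg_minnP (fun D => #|D :\: S|) P0) => D /and3P[Dc /set0Pn[t /setIP[tS tD]]].
move=> /subsetPn[f fD fS] minD; have [DZ _ _] := circuitP _ Dc.
exists (S :|: D), f; split; rewrite ?subsetUl ?inE ?fD ?orbT //.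
  have jt e : e \in S :|: D -> joined (S :|: D) t e.
    rewrite inE => /orP[eS|eD]; last by exists D; rewrite subsetUr.
    have [C [Cc CS tC eC]] := lS t e tS eS.
    by exists C; rewrite subsetU ?CS.
  by move=> e e' /jt/joined_sym et /jt; apply: joined_trans.
have DS' : D \in within (S :|: D) by rewrite inE DZ subsetUr.
have SS' X : X \in within S -> X \in within (S :|: D).
  by rewrite !inE => /andP[-> XS]; rewrite subsetU ?XS.
have -> : within (S :|: D) = within S :|: [set symd D X | X in within S].
  apply/setP=> X; rewrite in_setU; apply/idP/orP => [XS'|[/SS' //|]]; last first.
    by case/imsetP=> Y /SS' YS' ->; rewrite symd_within.
  have := XS'; rewrite inE => /andP[XZ XSD].
  case XS: (X \subset S); [by left; rewrite inE XZ | right].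
  have {XS}/subsetPn[y yX yS] := negbT XS.
  have [C [Cc CX yC]] := circuit_sub XZ yX; have [CZ C0 _] := circuitP _ Cc.
  have CD z : z \in C -> z \notin S -> z \in D.
    by move=> /(subsetP CX)/(subsetP XSD); rewrite inE => /orP[->|].
  (* disjoint from S, it would be a proper part of the circuit D *)
  have PC : P C.
    rewrite /P Cc /=; apply/andP; split; last by apply/subsetPn; exists y.
    apply/negP=> /eqP CS0.
    suff CE : C = set0 by rewrite CE eqxx in C0.
    have CS z : z \in C -> z \notin S.
      by move=> zC; apply/negP=> zS; have := in_set0 z; rewrite -CS0 inE zS zC.
    apply: (circuit_proper Dc CZ _ tD).
      by apply/subsetP=> z zC; apply: CD => //; apply: CS.
    by apply/negP=> /CS; rewrite tS.
  have sub1 : C :\: S \subset D :\: S.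
    by apply/subsetP=> z /setDP[zC zS]; rewrite inE zS CD.
  have /eqP/setP eqD : C :\: S == D :\: S by rewrite eqEcard sub1 (minD C PC).
  apply/imsetP; exists (symd D X); last by rewrite symdK.
  rewrite inE ZD //=; apply/subsetP=> z; rewrite in_symd; apply: contraTT => zS.
  have := eqD z; rewrite !inE (negPf zS) /= => zCD.
  have := subsetP XSD z; have := subsetP CX z; rewrite inE (negPf zS) zCD /=.
  by case: (z \in X); case: (z \in D) => //= h1 h2; case: notF; auto.
have inj : injective (symd D) by move=> X Y /(congr1 (symd D)); rewrite !symdK.
rewrite cardsU card_imset // mul2n -addnn.
suff -> : within S :&: [set symd D X | X in within S] = set0 by rewrite cards0 subn0.
apply/setP=> X; rewrite !inE; apply/negP=> /andP[/andP[_ XS] /imsetP[Y]].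
rewrite inE => /andP[_ YS] XE; move/negP: fS; apply.
have := subsetP XS f; have := subsetP YS f; rewrite XE in_symd fD.
by case: (f \in Y) => h1 h2; [apply: h1 | apply: h2].
Qed.

(** Grow from a single circuit to the whole set.  At the step from dimension [k] to
[k.+1], the circuits through a chosen element of the ear are new, and there are at
least [k.+1] of them because they span. *)
Lemma linked_lower_bound r : linked [set: T] -> 2 ^ r <= #|Z| -> 'C(r.+1, 2) <= #|[set C | circuit C]|.
Proof.
move=> lT ler; have [x0 _ | T0] := pickP T; last first.
  have Z1 : Z \subset [set set0].
    apply/subsetP=> X _; rewrite inE; apply/eqP/setP=> x; by have := T0 x.
  case: r ler => [|r] //; rewrite leqNgt (leq_ltn_trans (subset_leq_card Z1)) //.
  by rewrite cards1 -{1}(expn0 2) ltn_exp2l.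
have wT : within [set: T] = Z by apply/setP=> X; rewrite inE subsetT andbT.
pose inside (S : {set T}) := [set C | circuit C && (C \subset S)].
suff main n (S : {set T}) k : #|~: S| < n -> linked S -> S != set0 -> #|within S| = 2 ^ k ->
    'C(k.+1, 2) <= #|inside S| -> 'C(r.+1, 2) <= #|[set C | circuit C]|.
  have [C [Cc _ xC _]] := lT x0 x0 (in_setT _) (in_setT _).
  have [CZ C0 minC] := circuitP _ Cc.
  apply: (main _ C 1 (ltnSn _)) => //.
  - by move=> e f eC fC; exists C.
  - have -> : within C = [set set0; C].
      apply/setP=> X; rewrite !inE; apply/andP/orP=> [[XZ XC]|[]/eqP->]; last by [].
        by have [->|X0] := eqVneq X set0; [left | right; apply/eqP/minC].
      by rewrite Z0 sub0set.
    by rewrite cards2 eq_sym C0.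
  - by rewrite binn card_gt0; apply/set0Pn; exists C; rewrite inE Cc subxx.
elim: n S k => // n IH S k leS lS S0 wS cS.
have [ST|/subsetPn[x _ xS]] := boolP ([set: T] \subset S).
  have SE : S = [set: T] by apply/eqP; rewrite eqEsubset subsetT.
  move: wS cS; rewrite SE wT => wS cS.
  rewrite wS leq_exp2l // in ler; apply: leq_trans (leq_trans cS _).
    by apply: leq_bin2l.
  by apply/subset_leq_card/subsetP=> C; rewrite !inE => /andP[].
have [S' [f [lS' SS' fS' fS wS']]] := linked_grow lT lS S0 xS.
rewrite wS -expnS in wS'.
apply: (IH S' k.+1) => //.
- apply: leq_trans _ (leS : #|~: S| <= n).
  apply/proper_card/properP; split; first by rewrite setCS.
  by exists f; rewrite !inE ?fS ?fS'.
- by have [s sS] := set0Pn _ S0; apply/set0Pn; exists s; apply: (subsetP SS').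
- have := card_within_le lS' fS'; rewrite wS' leq_exp2l // => lek.
  rewrite binS bin1 addnC.
  have -> : inside S' = (inside S' :\: through S' f) :|: through S' f.
    apply/setP=> C; rewrite !inE; case: (circuit C) => //=.
    by case: (C \subset S') => //=; case: (f \in C).
  rewrite cardsU.
  have -> : (inside S' :\: through S' f) :&: through S' f = set0.
    apply/setP=> C; rewrite in_setI in_setD in_set0.
    by case: (C \in through S' f); rewrite ?andbF.
  rewrite cards0 subn0 addnC leq_add // (leq_trans cS) // subset_leq_card //.
  apply/subsetP=> C; rewrite !inE => /andP[Cc CS]; rewrite Cc (subset_trans CS SS') /=.
  by rewrite andbT; apply/negP=> /(subsetP CS); apply/negP.
Qed.

End Circuits.

(** * Cycles of a cubic graph *)

Lemma odd_card_symd (T : finType) (X Y : {set T}) :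
  odd #|symd X Y| = odd #|X| (+) odd #|Y|.
Proof.
have -> : symd X Y = (X :\: Y) :|: (Y :\: X).
  by apply/setP=> x; rewrite !inE; case: (x \in X); case: (x \in Y).
rewrite cardsU disjoint_setI0; last first.
  rewrite -setI_eq0; apply/eqP/setP=> x; rewrite !inE.
  by case: (x \in X); case: (x \in Y).
rewrite cards0 subn0 -(cardsID Y X) -(cardsID X Y) !oddD (setIC Y X).
by case: (odd #|X :&: Y|); case: (odd _); case: (odd _).
Qed.

Section GraphCycles.
Variable G : mgraph.
Implicit Types (X Y C : {set edge G}) (v u w : vertex G) (e f : edge G).

(** The boundary map of the graph modulo 2. *)
Definition bd X : {set vertex G} := [set v | odd #|[set e in X | v \in ends e]|].

Lemma in_bd X v : (v \in bd X) = odd #|[set e in X | v \in ends e]|.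
Proof. by rewrite inE. Qed.

Lemma bd_symd X Y : bd (symd X Y) = symd (bd X) (bd Y).
Proof.
apply/setP=> v; rewrite in_symd !in_bd -odd_card_symd; congr (odd _); apply: eq_card => e.
by rewrite !inE; case: (v \in ends e); rewrite ?andbT ?andbF.
Qed.

Lemma bd0 : bd set0 = set0.
Proof.
apply/setP=> v; rewrite in_bd in_set0 (eq_card (B := pred0)) ?card0 // => e.
by rewrite !inE.
Qed.

Lemma bd1 e : bd [set e] = ends e.
Proof.
apply/setP=> v; rewrite in_bd; case ve: (v \in ends e).
  rewrite (eq_card (B := pred1 e)) ?card1 // => f; rewrite !inE.
  by case: eqP => // ->; rewrite ve.
rewrite (eq_card (B := pred0)) ?card0 // => f; rewrite !inE.
by case: eqP => // ->; rewrite ve.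
Qed.

(** The handshake lemma. *)
Lemma odd_bd X : ~~ odd #|bd X|.
Proof.
have [n] := ubnP #|X|; elim: n X => // n IH X leX.
have [->|/set0Pn[e eX]] := eqVneq X set0; first by rewrite bd0 cards0.
have -> : X = symd [set e] (X :\ e).
  apply/setP=> f; rewrite in_symd !inE; case: eqP => [->|]; by rewrite ?eX.
rewrite bd_symd odd_card_symd bd1 card_ends /= IH //.
by move: leX; rewrite (cardsD1 e X) eX.
Qed.

Definition cycle_space : {set {set edge G}} := [set X | bd X == set0].

Lemma cycle_space0 : set0 \in cycle_space.
Proof. by rewrite inE bd0. Qed.

Lemma cycle_spaceD X Y :
  X \in cycle_space -> Y \in cycle_space -> symd X Y \in cycle_space.
Proof. by rewrite !inE bd_symd => /eqP-> /eqP->; rewrite symd0. Qed.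

Lemma cycle_spaceP X :
  reflect (forall v, ~~ odd #|[set e in X | v \in ends e]|) (X \in cycle_space).
Proof.
rewrite inE; apply: (iffP eqP) => [X0 v|evX]; first by rewrite -in_bd X0 inE.
by apply/setP=> v; rewrite in_bd in_set0; apply/negbTE.
Qed.

(** A boundary is determined by its trace off [v0], since its cardinal is even, and
two edge sets with the same boundary differ by an even set. *)
Lemma card_cycle_space v0 : 2 ^ #|edge G| <= 2 ^ #|vertex G|.-1 * #|cycle_space|.
Proof.
pose rep (B : {set vertex G}) := odflt set0 [pick X | bd X :\ v0 == B].
have repP X : bd (rep (bd X :\ v0)) = bd X.
  rewrite /rep; case: pickP => [Y /eqP eqY | /(_ X)]; last by rewrite eqxx.
  apply/setP=> v; have [->|v_v0] := eqVneq v v0; last first.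
    by have /setP/(_ v) := eqY; rewrite !inE v_v0.
  have := odd_bd X; have := odd_bd Y; rewrite (cardsD1 v0 (bd Y)) (cardsD1 v0 (bd X)) eqY.
  rewrite !oddD !oddb.
  by case: (v0 \in bd Y); case: (v0 \in bd X); case: (odd #|_|).
pose h X := (bd X :\ v0, symd (rep (bd X :\ v0)) X).
have inj_h : injective h.
  by move=> X Y [-> /(congr1 (symd (rep (bd Y :\ v0))))]; rewrite !symdK.
have -> : 2 ^ #|edge G| = #|h @: [set: {set edge G}]|.
  by rewrite (card_imset _ inj_h) -powersetT card_powerset cardsT.
have -> : 2 ^ #|vertex G|.-1 = #|powerset (~: [set v0])|.
  by rewrite card_powerset cardsC1.
rewrite -cardsX; apply/subset_leq_card/subsetP=> p /imsetP[X _ ->].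
rewrite inE /= powersetE; apply/andP; split.
  by apply/subsetP=> v; rewrite !inE => /andP[].
by rewrite inE bd_symd repP; apply/eqP/setP=> v; rewrite in_symd addbb inE.
Qed.

(** When no edge of [C] leaves [A], these edges form a union of components of [C];
such parts are how disconnected even sets are split. *)
Definition touching (A : {set vertex G}) C : {set edge G} :=
  [set e in C | ends e :&: A != set0].

Lemma bd_touching (A : {set vertex G}) C v : v \in A -> (v \in bd (touching A C)) = (v \in bd C).
Proof.
move=> vA; rewrite !in_bd; congr (odd _); apply: eq_card => e; rewrite !inE.
case: (e \in C) => //=; case ve: (v \in ends e); last by rewrite andbF.
by rewrite andbT; apply/set0Pn; exists v; rewrite inE ve.
Qed.

Lemma touching_cycle_space (A : {set vertex G}) C : C \in cycle_space ->
  (forall e v, e \in touching A C -> v \in ends e -> v \in A) ->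
  touching A C \in cycle_space.
Proof.
rewrite !inE => /eqP bdC clA; apply/eqP/setP=> v; rewrite in_set0.
case vA: (v \in A); first by rewrite bd_touching // bdC in_set0.
rewrite in_bd (eq_card (B := pred0)) ?card0 // => e; rewrite inE.
by apply/negP=> /andP[eY ve]; rewrite (clA e v eY ve) in vA.
Qed.

Section Conn.
Variable H : vepair G.

Lemma adj_sym : symmetric (adj H).
Proof. by move=> u w; apply/existsP/existsP=> -[e]; rewrite setUC => eH; exists e. Qed.

Lemma adj_csym : connect_sym (adj H).
Proof. exact: sym_connect_sym adj_sym. Qed.

Lemma adjE u w : reflect (exists2 e, e \in H.2 & ends e = [set u; w]) (adj H u w).
Proof.
apply: (iffP existsP) => [[e /andP[eH /eqP]]|[e eH /eqP]]; first by exists e.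
by exists e; rewrite eH.
Qed.

Lemma sub_closed : is_subgraph H -> closed (adj H) (mem H.1).
Proof.
move=> /forall_inP sH; apply: intro_closed; first exact: adj_csym.
move=> u w /adjE[e /sH/subsetP eH eE] _; apply: eH; by rewrite eE set22.
Qed.

(** Connectedness without paths: a nonempty vertex set closed under adjacency is
everything.  This is how the number of components is always used. *)
Lemma connectedP : is_subgraph H ->
  reflect (H.1 != set0 /\
    forall A : {set vertex G}, A \subset H.1 -> A != set0 ->
     (forall u w, u \in A -> adj H u w -> w \in A) -> A = H.1) (is_connected H).
Proof.
move=> sH; have clH := sub_closed sH; apply: (iffP eqP) => [c1|[/set0Pn[u uH] all_closed]].
  have /card1P[r rP] : #|predI (roots (adj H)) (mem H.1)| == 1 by apply/eqP.
  have rootH u : u \in H.1 -> root (adj H) u = r.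
    move=> uH; apply/eqP; rewrite -[_ == r](rP (root (adj H) u)) inE /=.
    rewrite (roots_root adj_csym) /=.
    by rewrite -[_ \in _](closed_connect clH (connect_root _ u)).
  split.
    apply/set0Pn; exists r; have := rP r; rewrite !inE eqxx => /andP[_ ?]//.
  move=> A AH /set0Pn[a aA] clA; apply/eqP; rewrite eqEsubset AH /=.
  apply/subsetP=> w wH; have cA : closed (adj H) (mem A).
    by apply: intro_closed; [exact: adj_csym | move=> x y xy xA; apply: clA xy].
  have aw : connect (adj H) a w.
    by rewrite -(root_connect adj_csym) (rootH a) ?(rootH w) // (subsetP AH).
  by have := closed_connect cA aw; rewrite /= aA => <-.
rewrite /components.
have <- : [set w | connect (adj H) u w] = H.1.
  apply: all_closed.
  - by apply/subsetP=> w; rewrite inE => /(closed_connect clH) /= <-.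
  - by apply/set0Pn; exists u; rewrite inE connect0.
  - by move=> x y; rewrite !inE => ux xy; apply: connect_trans ux (connect1 xy).
rewrite -(n_comp_connect adj_csym u); apply: eq_n_comp_r => w.
by rewrite !inE.
Qed.

End Conn.

Lemma is_subgraph_whole : is_subgraph (whole G).
Proof. by apply/forall_inP=> e _; apply: subsetT. Qed.

Lemma is_subgraph_del v : is_subgraph (del_vertex v).
Proof.
apply/forall_inP=> e; rewrite inE => ve; apply/subsetP=> w we; rewrite !inE.
by apply: contra ve => /eqP <-.
Qed.

Lemma other_end e v : v \in ends e -> exists2 u, u != v & ends e = [set v; u].
Proof.
move=> ve; have /cards2P[a [b [ab eE]]] : #|ends e| == 2 by rewrite card_ends.
move: ve; rewrite eE !inE => /orP[]/eqP->; first by exists b; rewrite // eq_sym.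
by exists a; rewrite // setUC.
Qed.

Local Notation isC := (circuit cycle_space).
Local Notation edges_at C v := [set e in C | v \in ends e].

Hypothesis cubicG : cubic G.

Lemma deg3 v : #|[set e | v \in ends e]| = 3.
Proof.
have /forallP/(_ v)/eqP <- := cubicG; rewrite /degree; apply: eq_card => e.
by rewrite !inE.
Qed.

(** An even positive number that is at most 3. *)
Lemma deg_circuit C v e : C \in cycle_space -> e \in C -> v \in ends e ->
  #|edges_at C v| = 2.
Proof.
move=> /cycle_spaceP/(_ v) evC eC ve.
have : #|edges_at C v| <= 3.
  by rewrite -(deg3 v) subset_leq_card //; apply/subsetP=> f; rewrite !inE => /andP[].
have : 0 < #|edges_at C v| by apply/card_gt0P; exists e; rewrite inE eC.
by move: evC; case: #|_| => [|[|[|[|]]]].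
Qed.

(** A cycle is determined by its edges.  It is a minimal even set because the vertices
met by a nonempty even subset are closed under adjacency; a circuit is connected
because a component of it is even. *)
Lemma ncycles_circuits : ncycles G = #|[set C | isC C]|.
Proof.
pose cov C : {set vertex G} := \bigcup_(e in C) ends e.
have cyc1 (H : vepair G) : is_cycle H -> H.1 = cov H.2.
  case/and3P=> /forall_inP sH _ /forall_inP d2; apply/setP=> v; apply/idP/bigcupP.
    move=> /d2/eqP dv; have /card_gt0P[e] : 0 < #|edges_at H.2 v| by rewrite -/(degree H v) dv.
    by rewrite inE => /andP[? ?]; exists e.
  by case=> e eH ve; apply: (subsetP (sH e eH)).
rewrite /ncycles -(card_in_imset (f := snd)); last first.
  move=> [U X] [U' X']; rewrite !inE => /cyc1/= -> /cyc1/= -> /= -> //.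
congr #|pred_of_set _|; apply/setP=> C; rewrite inE; apply/imsetP/idP.
  case=> [[U X]]; rewrite inE => cH /= -> {C}; have /= UE := cyc1 _ cH.
  case/and3P: cH => sH cH /forall_inP /= d2.
  have sub := forall_inP sH.
  have {}d2 v : v \in U -> #|edges_at X v| = 2 by move=> /d2/eqP.
  have XZ : X \in cycle_space.
    apply/cycle_spaceP=> v; case vU: (v \in U); first by rewrite (d2 v vU).
    rewrite (eq_card (B := pred0)) ?card0 // => e; rewrite !inE; apply/negP=> /andP[eX ve].
    by have := subsetP (sub e eX) v ve; rewrite vU.
  have [/set0Pn[v vU] cl] := connectedP sH cH.
  apply/circuitP; split=> //.
    move: vU; rewrite /= UE => /bigcupP[e eX _]; by apply/set0Pn; exists e.
  move=> Y YZ YX Y0; pose A := cov Y.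
  have same u : u \in A -> edges_at Y u = edges_at X u.
    move=> /bigcupP[e eY ue].
    apply/eqP; rewrite eqEcard; apply/andP; split.
      by apply/subsetP=> f; rewrite !inE => /andP[/(subsetP YX)-> ->].
    rewrite (deg_circuit YZ eY ue); have uU : u \in U.
      by rewrite UE; apply/bigcupP; exists e => //; apply: (subsetP YX).
    by rewrite (d2 u uU).
  have AU : A = U.
    apply: cl => /=.
    - rewrite UE; apply/subsetP=> u /bigcupP[e eY ue].
      by apply/bigcupP; exists e => //; apply: (subsetP YX).
    - have [e eY] := set0Pn _ Y0.
      have /card_gt0P[u ue] : 0 < #|ends e| by rewrite card_ends.
      by apply/set0Pn; exists u; apply/bigcupP; exists e.
    - move=> u w uA /adjE[e /= eX eE].
      have : e \in edges_at X u by rewrite inE eX eE set21.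
      rewrite -(same u uA) inE => /andP[eY _]; apply/bigcupP; exists e => //.
      by rewrite eE set22.
  apply/eqP; rewrite eqEsubset YX /=; apply/subsetP=> e eX.
  have /card_gt0P[u ue] : 0 < #|ends e| by rewrite card_ends.
  have uA : u \in A by rewrite AU UE; apply/bigcupP; exists e.
  have : e \in edges_at X u by rewrite inE eX.
  by rewrite -(same u uA) inE => /andP[].
move=> Cc; have [CZ /set0Pn[e eC] minC] := circuitP _ _ Cc.
exists (cov C, C) => //; rewrite inE; apply/and3P.
have sH : is_subgraph (cov C, C).
  by apply/forall_inP=> f /= fC; apply/subsetP=> v vf; apply/bigcupP; exists f.
split=> //; last first.
  by apply/forall_inP=> v /bigcupP[f fC vf]; rewrite /degree /= (deg_circuit CZ fC vf).
apply/(connectedP sH); split=> /=.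
  have /card_gt0P[u ue] : 0 < #|ends e| by rewrite card_ends.
  by apply/set0Pn; exists u; apply/bigcupP; exists e.
move=> A AU /set0Pn[a aA] clA; pose Y := touching A C.
have clY f v : f \in Y -> v \in ends f -> v \in A.
  rewrite inE => /andP[fC /set0Pn[u /setIP[uf uA]]] vf.
  have [w wu fE] := other_end uf; move: vf; rewrite fE !inE => /orP[/eqP->//|/eqP->].
  by apply: (clA _ _ uA); apply/adjE; exists f.
have YE : Y = C.
  apply: minC; last first.
  - have /bigcupP[f fC af] := subsetP AU a aA; apply/set0Pn; exists f; rewrite inE fC.
    by apply/set0Pn; exists a; rewrite inE af.
  - by apply/subsetP=> f; rewrite inE => /andP[].
  exact: touching_cycle_space.
apply/eqP; rewrite eqEsubset AU /=; apply/subsetP=> v /bigcupP[f fC vf].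
by apply: clY vf; rewrite YE.
Qed.

Lemma edge_at v : exists e, v \in ends e.
Proof.
have /card_gt0P[e] : 0 < #|[set e | v \in ends e]| by rewrite deg3.
by rewrite inE; exists e.
Qed.

(** If the other vertices split into two parts with no edge between them, take an edge
from the cut vertex [v] to each part, and a circuit through both.  The edges of this
circuit that touch one part have boundary [v] alone, against the handshake lemma. *)
Lemma linked_inseparable : 0 < #|vertex G| -> linked cycle_space [set: edge G] ->
  inseparable G.
Proof.
move=> V0 lG; have join e f : exists C, [/\ isC C, e \in C & f \in C].
  by have [C [? _ ? ?]] := lG e f (in_setT _) (in_setT _); exists C.
have conn : is_connected (whole G).
  apply/(connectedP is_subgraph_whole); split=> /=; first by rewrite -card_gt0 cardsT.
  move=> A _ /set0Pn[u uA] clA; apply/eqP; rewrite eqEsubset subsetT /=.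
  apply/subsetP=> w _; apply/negPn/negP=> wA.
  have [e ue] := edge_at u; have [f wf] := edge_at w; have [C [Cc eC fC]] := join e f.
  have [CZ _ minC] := circuitP _ _ Cc.
  pose Y := touching A C.
  have clY g v : g \in Y -> v \in ends g -> v \in A.
    rewrite inE => /andP[gC /set0Pn[x /setIP[xg xA]]] vg.
    have [y yx gE] := other_end xg; move: vg; rewrite gE !inE => /orP[/eqP->//|/eqP->].
    by apply: (clA _ _ xA); apply/adjE; exists g; rewrite ?inE.
  have YE : Y = C.
    apply: minC; last first.
    - by apply/set0Pn; exists e; rewrite inE eC; apply/set0Pn; exists u; rewrite inE ue.
    - by apply/subsetP=> g; rewrite inE => /andP[].
    exact: touching_cycle_space.
  by move/negP: wA; apply; apply: clY wf; rewrite YE.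
rewrite /inseparable conn; apply/forallP=> v; rewrite /cutpoint -leqNgt.
rewrite (eqP conn).
have [H0|H0] := eqVneq (del_vertex v).1 set0.
  rewrite /components /n_comp_mem eq_card0 // => x; rewrite !inE.
  have := in_set0 x; rewrite -H0 !inE => ->; by rewrite andbF.
suff /eqP-> : is_connected (del_vertex v) by [].
apply/(connectedP (is_subgraph_del v)); split=> //.
move=> A Av A0 clA; apply/eqP; rewrite eqEsubset Av /=; apply/subsetP=> w0 w0v.
apply/negPn/negP=> w0A.
have exit (B : {set vertex G}) : B != set0 -> v \notin B ->
  (forall x y, x \in B -> adj (del_vertex v) x y -> y \in B) ->
  exists2 e, v \in ends e & ends e :&: B != set0.
  move=> B0 vB clB; apply/exists_inP; apply: contraR vB => /exists_inPn none.
  have [_ /(_ B (subsetT _) B0) ->//] := connectedP is_subgraph_whole conn.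
  move=> x y xB /adjE[e _ eE]; have : x \in ends e by rewrite eE set21.
  move=> xe; apply: (clB _ _ xB); apply/adjE; exists e => //; rewrite inE.
  apply/negP=> /none; rewrite negbK => /eqP/setP/(_ x); by rewrite !inE xe xB.
have vA : v \notin A by apply/negP=> /(subsetP Av); rewrite !inE eqxx.
have [e ve eA] := exit A A0 vA clA.
pose B := (del_vertex v).1 :\: A.
have [|||f vf fB] := exit B.
- by apply/set0Pn; exists w0; rewrite inE w0A.
- by rewrite !inE eqxx andbF.
- move=> x y; rewrite !inE => /andP[xA xv] xy; apply/andP; split.
    by apply: contra xA => yA; apply: (clA _ _ yA); rewrite adj_sym.
  have := closed_connect (sub_closed (is_subgraph_del v)) (connect1 xy).
  by rewrite /= !inE => <-.
have [C [Cc eC fC]] := join e f; have [CZ _ _] := circuitP _ _ Cc.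
pose Y := touching A C.
have eY : e \in Y by rewrite inE eC.
have nonY g : v \in ends g -> ends g :&: B != set0 -> ends g :&: A = set0.
  move=> vg /set0Pn[y /setIP[yg yB]]; have [u uv gE] := other_end vg.
  have yu : y = u.
    move: yg; rewrite gE !inE => /orP[/eqP yv|/eqP//].
    by move: yB; rewrite yv !inE eqxx andbF.
  apply/setP=> z; rewrite gE !inE; apply/negP=> /andP[/orP[]/eqP-> zA].
    by rewrite zA in vA.
  by move: yB; rewrite yu !inE zA.
have fY : f \notin Y by rewrite inE fC (nonY f) // eqxx.
have ef : e != f by apply: contraNneq fY => <-.
have at_v : edges_at C v = [set e; f].
  apply/esym/eqP; rewrite eqEcard (deg_circuit CZ eC ve) cards2 ef andbT.
  by apply/subsetP=> g; rewrite !inE => /orP[]/eqP->; rewrite ?eC ?fC.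
suff bdY : bd Y = [set v] by have := odd_bd Y; rewrite bdY cards1.
apply/setP=> x; rewrite in_bd [RHS]inE; case: eqP => [->|/eqP xv].
  rewrite (eq_card (B := pred1 e)) ?card1 // => g; rewrite !inE.
  have [->|ge] := eqVneq g e; first by rewrite eC eA ve.
  apply/negP=> /andP[/andP[gC gA] vg]; have : g \in edges_at C v by rewrite inE gC.
  rewrite at_v !inE (negPf ge) /= => /eqP gf; move: fY; by rewrite inE -gf gC gA.
case xA: (x \in A).
  by rewrite -in_bd bd_touching //; move: CZ; rewrite inE => /eqP->; rewrite in_set0.
rewrite (eq_card (B := pred0)) ?card0 // => g; rewrite !inE.
apply/negP=> /andP[/andP[gC /set0Pn[y /setIP[yg yA]]] xg].
have [u uy gE] := other_end yg; have xu : x = u.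
  by move: xg; rewrite gE !inE => /orP[/eqP xy|/eqP//]; rewrite -xy xA in yA.
suff : x \in A by rewrite xA.
apply: (clA _ _ yA); apply/adjE; exists g; rewrite ?gE ?xu // inE gE !inE -xu.
apply/norP; split; last by rewrite eq_sym.
by apply: contraNneq vA => ->.
Qed.

(** Two edges [e] and [f] at [v] lie on a common circuit: their other ends are connected
in the graph without [v], and a path there closes [e] and [f] to an even set whose only
edges at [v] are these two; so a circuit through [e] inside it also uses [f].
Transitivity and connectedness do the rest. *)
Lemma inseparable_linked : inseparable G -> linked cycle_space [set: edge G].
Proof.
case/andP=> conn /forallP ncut.
have ZD := cycle_spaceD.
pose J := joined cycle_space [set: edge G].
have J_adj v e f : e != f -> v \in ends e -> v \in ends f -> J e f.
  move=> ef ve vf; have [u uv eE] := other_end ve; have [w wv fE] := other_end vf.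
  pose A := [set x | (x != v) && [exists Y : {set edge G},
       [forall g in Y, v \notin ends g] && (bd Y == symd [set u] [set x])]].
  have dv : is_connected (del_vertex v).
    have := ncut v; rewrite /cutpoint -leqNgt (eqP conn) => c1.
    rewrite /is_connected eqn_leq c1 /=; apply/card_gt0P.
    exists (root (adj (del_vertex v)) u); rewrite inE /=.
    rewrite (roots_root (adj_csym _)) /=.
    rewrite -[_ \in _](closed_connect (sub_closed (is_subgraph_del v)) (connect_root _ u)).
    by rewrite /= !inE.
  have : w \in A.
    have [_ cl] := connectedP (is_subgraph_del v) dv; rewrite (cl A).
    - by rewrite !inE.
    - by apply/subsetP=> x; rewrite !inE => /andP[].
    - apply/set0Pn; exists u; rewrite inE uv; apply/existsP; exists set0.
      apply/andP; split; first by apply/forall_inP=> g; rewrite inE.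
      by apply/eqP; rewrite bd0; apply/setP=> x; rewrite in_symd addbb inE.
    - move=> x y; rewrite !inE => /andP[xv /existsP[Y /andP[/forall_inP vY /eqP bdY]]].
      case/adjE=> g; rewrite inE => vg gE.
      have xy : x != y by have := card_ends g; rewrite gE cards2; case: (x != y).
      apply/andP; split; first by apply: contraNneq vg => <-; rewrite gE set22.
      apply/existsP; exists (symd Y [set g]); apply/andP; split.
        apply/forall_inP=> h; rewrite in_symd inE.
        by have [-> //|_] := eqVneq h g; rewrite addbF => /vY.
      rewrite bd_symd bdY bd1 gE; apply/eqP/setP=> z; rewrite !in_symd !inE.
      have [->|zx] := eqVneq z x; last by rewrite addbF.
      by rewrite (negPf xy); case: (x == u).
  rewrite inE => /andP[_ /existsP[Y /andP[/forall_inP vY /eqP bdY]]].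
  pose X := symd Y (symd [set e] [set f]).
  have XZ : X \in cycle_space.
    rewrite inE !bd_symd bdY !bd1 eE fE; apply/eqP/setP=> z; rewrite !in_symd !inE.
    have [->|_] := eqVneq z v; first by rewrite !(eq_sym v) (negPf uv) (negPf wv).
    by case: (z == u); case: (z == w).
  have Xv g : v \in ends g -> (g \in X) = (g == e) || (g == f).
    move=> vg; rewrite !in_symd !inE; have -> : g \in Y = false.
      by apply/negP=> /vY; rewrite vg.
    by have [->|] := eqVneq g e; rewrite ?(negPf ef).
  have [|C [Cc CX eC]] := circuit_sub ZD XZ (e := e); first by rewrite Xv ?eqxx.
  have [CZ _ _] := circuitP _ _ Cc.
  exists C; split=> //; apply/negPn/negP=> fC.
  have /cycle_spaceP/(_ v) := CZ; rewrite (eq_card (B := pred1 e)) ?card1 // => g.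
  rewrite !inE; have [->|ge] := eqVneq g e; first by rewrite eC.
  apply/negP=> /andP[gC vg]; have := subsetP CX g gC; rewrite Xv // (negPf ge) /=.
  by move=> /eqP gf; rewrite gf in gC; rewrite gC in fC.
have J_refl e : J e e.
  have /card_gt0P[v ve] : 0 < #|ends e| by rewrite card_ends.
  have : 0 < #|[set f | v \in ends f] :\ e|.
    by have := deg3 v; rewrite (cardsD1 e) inE ve; case: #|_|.
  case/card_gt0P=> f; rewrite !inE => /andP[fe vf].
  have [C [? ? ? ?]] : J e f by apply: J_adj ve vf; rewrite eq_sym.
  by exists C.
have J_adj' v e f : v \in ends e -> v \in ends f -> J e f.
  by have [-> _ _|] := eqVneq e f; [apply: J_refl | apply: J_adj].
move=> e f _ _.
pose P x := exists2 g, x \in ends g & J e g.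
have Pe x : x \in ends e -> P x by move=> xe; exists e.
have Padj x g y : x \in ends g -> y \in ends g -> P x -> P y.
  move=> xg yg [h xh eh]; exists g => //.
  by apply: (joined_trans ZD eh); apply: J_adj' xh xg.
have /card_gt0P[u ue] : 0 < #|ends e| by rewrite card_ends.
have /card_gt0P[w wf] : 0 < #|ends f| by rewrite card_ends.
suff [g wg eg] : P w by apply: (joined_trans ZD eg); apply: J_adj' wg wf.
have uw : connect (adj (whole G)) u w.
  pose A := [set x | connect (adj (whole G)) u x].
  have [_ cl] := connectedP is_subgraph_whole conn.
  have : w \in A; last by rewrite inE.
  rewrite (cl A) ?inE //; first exact: subsetT.
    by apply/set0Pn; exists u; rewrite inE connect0.
  by move=> x y; rewrite !inE => ux xy; apply: connect_trans ux (connect1 xy).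
have := Pe u ue; case/connectP: uw => p; elim: p u {ue} => [|y p IH] u /=; first by move=> _ ->.
case/andP=> /adjE[g _ gE] py lw Pu; apply: (IH y) => //.
by apply: (Padj u g) => //; rewrite gE ?set21 ?set22.
Qed.

End GraphCycles.

(** * Circuits computed from a list of links *)

(** An edge given by the places of its ends. *)
Definition link := (nat * nat)%type.

Section LinkLists.
Implicit Types (x y : link) (s : seq link) (p b c : bitseq) (v m : nat).

Definition meets v x := (v == x.1) || (v == x.2).

(** The order of the first ends is what lets [even_masks] give up early. *)
Definition valid m s :=
  all (fun x => x.1 < x.2 < m) s && sorted leq [seq x.1 | x <- s].

Definition flip p x : bitseq :=
  set_nth false (set_nth false p x.1 (~~ nth false p x.1)) x.2 (~~ nth false p x.2).

(** The subsets of [s] with boundary [p], as masks.  Since the links are sorted, the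
vertices before [x.1] have no link left, and a branch in which one of them is still odd
is cut; this keeps the search tree narrow. *)
Fixpoint even_masks s p : seq bitseq :=
  if s is x :: s' then
    if has id (take x.1 p) then [::] else
    [seq false :: b | b <- even_masks s' p] ++ [seq true :: b | b <- even_masks s' (flip p x)]
  else if has id p then [::] else [:: [::]].

Definition submask b c := all2 implb b c.

Definition circuit_masks m s : seq bitseq :=
  let ev := [seq b <- even_masks s (nseq m false) | has id b] in
  [seq b <- ev | all (fun c => submask c b ==> (c == b)) ev].

Definition parity s b v := odd (count (fun xb => xb.2 && meets v xb.1) (zip s b)).

Lemma nth_flip p x v : x.1 != x.2 -> nth false (flip p x) v = nth false p v (+) meets v x.
Proof.
move=> ij; rewrite /flip !nth_set_nth /= nth_set_nth /= /meets.
case: (v =P x.2) => [->|_]; first by rewrite orbT addbT.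
by case: (v =P x.1) => [->|_]; rewrite /= ?addbT ?addbF.
Qed.

Lemma has_id_nth p : reflect (exists v, nth false p v) (has id p).
Proof.
apply: (iffP idP) => [/(has_nthP false)[v _ pv]|[v pv]]; first by exists v.
apply/(has_nthP false); exists v => //; rewrite ltnNge; apply/negP=> le.
by rewrite nth_default in pv.
Qed.

Lemma even_masksP m s p b : valid m s ->
  reflect (size b = size s /\ forall v, parity s b v = nth false p v) (b \in even_masks s p).
Proof.
elim: s p b => [|x s IH] p b.
  move=> _ /=; case: ifP => [hp|/negP hp].
    apply: (iffP idP) => // -[_ pb]; have [v] := has_id_nth _ hp.
    by rewrite -pb /parity; case: (b).
  apply: (iffP idP); first rewrite mem_seq1 => /eqP->; first split=> // v.
    by apply/esym/negP=> pv; case: hp; apply/has_id_nth; exists v.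
  by case=> /eqP/nilP->.
case/andP=> /= /andP[/andP[lt12 lt2m] sm] xs.
have ne12 : x.1 != x.2 by rewrite neq_ltn lt12.
have vs : valid m s by rewrite /valid sm (path_sorted xs).
have far v : v < x.1 -> forall c, parity (x :: s) c v = false.
  move=> vx c; rewrite /parity (eq_in_count (a2 := pred0)) ?count_pred0 // => -[y d] ymem.
  have /= ys : y \in x :: s.
    elim: (x :: s) c ymem {sm xs vs IH} => [|z l IHl] [|a c] //=; rewrite !inE.
    by case/orP=> [/eqP[-> _]|/IHl->]; rewrite ?eqxx ?orbT.
  apply/negbTE; rewrite negb_and; apply/orP; right; rewrite /meets /=.
  have [le1 lt2] : x.1 <= y.1 /\ y.1 < y.2.
    move: ys; rewrite inE => /orP[/eqP->//|ys]; split.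
      have := order_path_min leq_trans xs => /allP; apply; exact: map_f.
    by have /andP[] := allP sm _ ys.
  have vy := leq_trans vx le1; rewrite !ltn_eqF //; exact: ltn_trans vy lt2.
have consP a c v : parity (x :: s) (a :: c) v = parity s c v (+) (a && meets v x).
  by rewrite /parity /= oddD oddb addbC.
case: ifP => [hp|_].
  apply: (iffP idP) => // -[_ pb]; have [v pv] := has_id_nth _ hp.
  move/(_ v): pb; have vx : v < x.1.
    rewrite ltnNge; apply: contraL pv => le.
    by rewrite nth_default // size_take_min (leq_trans (geq_minl _ _)).
  by rewrite far //; move: pv; rewrite nth_take // => ->.
rewrite mem_cat; apply: (iffP orP) => [[]/mapP[c /(IH _ _ vs)[sc pc] ->]|].
- by rewrite /= sc; split=> // v; rewrite consP addbF pc.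
- by rewrite /= sc; split=> // v; rewrite consP pc nth_flip // -addbA addbb addbF.
case: b => [|a b] [] //= [sb] pb; case: a pb => pb; [right|left]; apply: map_f.
  by apply/(IH _ _ vs); split=> // v; rewrite nth_flip // -pb consP -addbA addbb addbF.
by apply/(IH _ _ vs); split=> // v; rewrite -pb consP addbF.
Qed.

Lemma uniq_even_masks s p : uniq (even_masks s p).
Proof.
elim: s p => [|x s IH] p /=; first by case: ifP.
case: ifP => // _; rewrite cat_uniq !map_inj_uniq ?IH /= ?andbT; try by move=> ? ? [].
by apply/hasPn=> _ /mapP[b _ ->]; apply/negP=> /mapP[].
Qed.

Lemma submaskP n b c : size b = n -> size c = n ->
  reflect (forall k, k < n -> nth false b k -> nth false c k) (submask b c).
Proof.
move=> <-; elim: b c => [|a b IH] [|d c] //=; first by move=> _; apply: ReflectT.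
case=> sc; apply: (iffP andP) => [[ad /(IH _ sc) bc] [|k] //=|bc].
  by move=> _ ai; rewrite (implyP ad).
by move/bc.
split; first by apply/implyP/(bc 0).
by apply/(IH _ sc) => k /(bc k.+1).
Qed.

(** An isomorphism from [G] to the graph on [0 .. m-1] with links [s], given by two
injections; the cardinals make them bijections. *)
Record coded (G : mgraph) m s := Coded {
  pos : vertex G -> nat;
  idx : edge G -> nat;
  pos_inj : injective pos;
  pos_lt : forall u, pos u < m;
  card_pos : #|vertex G| = m;
  idx_inj : injective idx;
  idx_lt : forall e, idx e < size s;
  card_idx : #|edge G| = size s;
  in_ends : forall e u, (u \in ends e) = meets (pos u) (nth (0, 0) s (idx e)) }.

Section Ranks.
Variables (T : finType) (f : T -> nat) (n : nat).
Hypotheses (f_inj : injective f) (f_lt : forall t, f t < n) (cT : #|T| = n).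

Lemma perm_rank : perm_eq [seq f t | t <- enum T] (iota 0 n).
Proof.
have uf : uniq [seq f t | t <- enum T] by rewrite map_inj_uniq ?enum_uniq.
have sub : {subset [seq f t | t <- enum T] <= iota 0 n}.
  by move=> _ /mapP[t _ ->]; rewrite mem_iota f_lt.
apply: uniq_perm => //; first exact: iota_uniq.
by apply: (uniq_min_size uf sub _).2; rewrite size_map size_iota -cardE cT.
Qed.

Lemma card_rank (P : pred nat) : #|[pred t | P (f t)]| = count P (iota 0 n).
Proof.
rewrite -(seq.permP perm_rank) count_map.
by rewrite cardE {1}/enum_mem size_filter enumT; apply: eq_count.
Qed.

Lemma rank_onto k : k < n -> exists t, f t = k.
Proof.
move=> kn; have : k \in iota 0 n by rewrite mem_iota.
by rewrite -(perm_mem perm_rank) => /mapP[x _ ->]; exists x.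
Qed.
End Ranks.

Section Coded.
Variables (G : mgraph) (m : nat) (s : seq link) (K : coded G m s).
Hypothesis vs : valid m s.
Local Notation Z := (cycle_space G).

(** The edge set selected by a mask. *)
Definition edges_of b : {set edge G} := [set e | nth false b (idx K e)].

Let idx_onto k : k < size s -> exists e, idx K e = k.
Proof. by move=> ks; apply: rank_onto ks; [apply: idx_inj | apply: idx_lt | apply: card_idx K]. Qed.

Let pos_onto k : k < m -> exists u, pos K u = k.
Proof. by move=> ks; apply: rank_onto ks; [apply: pos_inj | apply: pos_lt | apply: card_pos K]. Qed.

Let card_idx_pred (P : pred nat) : #|[pred e | P (idx K e)]| = count P (iota 0 (size s)).
Proof. by apply: card_rank; [apply: idx_inj | apply: idx_lt | apply: card_idx K]. Qed.

Lemma edges_ofK b c : size b = size s -> size c = size s -> edges_of b = edges_of c -> b = c.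
Proof.
move=> sb sc /setP eqbc; apply: (@eq_from_nth _ false) => [|k]; first by rewrite sb.
rewrite sb => /idx_onto[e ek].
by have := eqbc e; rewrite !inE ek.
Qed.

Lemma edges_of_onto (X : {set edge G}) : exists2 b, size b = size s & edges_of b = X.
Proof.
exists [seq [exists e in X, idx K e == k] | k <- iota 0 (size s)].
  by rewrite size_map size_iota.
apply/setP=> e; rewrite inE (nth_map 0) ?size_iota ?idx_lt // nth_iota ?idx_lt // add0n.
by apply/exists_inP/idP => [[f fX /eqP/idx_inj<-//]|eX]; exists e.
Qed.

Lemma edges_of_sub b c : size b = size s -> size c = size s ->
  (edges_of b \subset edges_of c) = submask b c.
Proof.
move=> sb sc; apply/subsetP/(submaskP sb sc) => [sub k /idx_onto[e ek] bk|sub e].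
  by have := sub e; rewrite !inE ek; apply.
by rewrite !inE; apply: sub; apply: idx_lt.
Qed.

Lemma parity_edges b (v : vertex G) : size b = size s ->
  parity s b (pos K v) = odd #|[set e in edges_of b | v \in ends e]|.
Proof.
move=> sb; rewrite /parity; congr (odd _); pose P k :=
  nth false b k && meets (pos K v) (nth (0,0) s k).
rewrite (eq_card (B := [pred e | P (idx K e)])); last first.
  by move=> e; rewrite !inE (in_ends K).
rewrite card_idx_pred -{1}(mkseq_nth ((0, 0), false) (zip s b)) /mkseq count_map.
by rewrite size_zip sb minnn; apply: eq_in_count => k _ /=; rewrite nth_zip.
Qed.

Lemma even_masks_cycle_space b : size b = size s ->
  (b \in even_masks s (nseq m false)) = (edges_of b \in Z).
Proof.
move=> sb; apply/(even_masksP _ _ vs)/cycle_spaceP => [[_ pb] v|evb].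
  by rewrite -parity_edges // pb nth_nseq if_same.
split=> // v; rewrite nth_nseq if_same; have [vm|mv] := ltnP v m.
  have [u <-] := pos_onto vm.
  by rewrite parity_edges //; apply/negbTE.
rewrite /parity (eq_in_count (a2 := pred0)) ?count_pred0 // => -[y d] ymem.
have ys : y \in s.
  have := map_f fst ymem; rewrite -/(unzip1 _) unzip1_zip //; by rewrite sb.
have /andP[/allP/(_ y ys) /andP[lt1 lt2] _] := vs.
rewrite /= /meets !(gtn_eqF (leq_trans _ mv)) ?andbF //.
exact: ltn_trans lt1 lt2.
Qed.

Lemma edges_of0 b : size b = size s -> (edges_of b != set0) = has id b.
Proof.
move=> sb; apply/set0Pn/has_id_nth => [[e]|[k bk]]; first by rewrite inE; exists (idx K e).
have ks : k < size s by rewrite ltnNge -sb; apply: contraL bk => /(nth_default false)->.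
by have [e ek] := idx_onto ks; exists e; rewrite inE ek.
Qed.

Lemma size_even_masks b p : b \in even_masks s p -> size b = size s.
Proof. by case/(even_masksP _ _ vs). Qed.

Lemma circuit_masksP b : reflect (size b = size s /\ circuit Z (edges_of b)) (b \in circuit_masks m s).
Proof.
rewrite mem_filter [b \in filter _ _]mem_filter.
apply: (iffP and3P) => [[/allP minb b0 bev]|[sb /circuitP[bZ b0 minb]]].
  have sb := size_even_masks bev; split=> //; apply/circuitP; split.
  - by rewrite -even_masks_cycle_space.
  - by rewrite edges_of0.
  move=> X XZ Xb X0; have [c sc cX] := edges_of_onto X; rewrite -cX in XZ Xb X0 *.
  have cev : c \in [seq b <- even_masks s (nseq m false) | has id b].
    by rewrite mem_filter -edges_of0 // X0 even_masks_cycle_space.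
  by have := minb c cev; rewrite -edges_of_sub // Xb => /eqP->.
split; rewrite -?edges_of0 ?even_masks_cycle_space //.
apply/allP=> c; rewrite mem_filter => /andP[c0 cev]; have sc := size_even_masks cev.
apply/implyP; rewrite -edges_of_sub // => sub; apply/eqP/edges_ofK => //.
by apply: minb => //; rewrite ?edges_of0 // -even_masks_cycle_space.
Qed.

Lemma card_circuits (Q : pred {set edge G}) (q : pred bitseq) :
  (forall b, size b = size s -> Q (edges_of b) = q b) ->
  #|[set C | circuit Z C && Q C]| = count q (circuit_masks m s).
Proof.
move=> eqQ; rewrite -size_filter cardE -(size_map edges_of); apply/perm_size/uniq_perm.
- exact: enum_uniq.
- rewrite map_inj_in_uniq.
    by rewrite !filter_uniq ?uniq_even_masks.
  move=> b c; rewrite [b \in _]mem_filter [c \in _]mem_filter => /andP[_ /circuit_masksP[sb _]].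
  by case/andP=> _ /circuit_masksP[sc _]; apply: edges_ofK.
move=> C; rewrite mem_enum inE; apply/andP/mapP => [[Cc QC]|[b]].
  have [b sb bC] := edges_of_onto C; exists b => //.
  by rewrite mem_filter -eqQ // bC QC; apply/circuit_masksP; rewrite bC.
by rewrite mem_filter => /andP[qb /circuit_masksP[sb cb]] ->; rewrite eqQ.
Qed.

Lemma coded_cubic : all (fun v => count (meets v) s == 3) (iota 0 m) -> cubic G.
Proof.
move=> /allP d3; apply/forallP=> v; rewrite /degree /=.
pose P k := meets (pos K v) (nth (0,0) s k).
rewrite (eq_card (B := [pred e | P (idx K e)])); last first.
  by move=> e; rewrite !inE (in_ends K).
have /d3/eqP <- : pos K v \in iota 0 m by rewrite mem_iota pos_lt.
rewrite card_idx_pred {}/P; move: (pos K v) => k.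
by rewrite -[in X in _ == X](mkseq_nth (0, 0) s) /mkseq count_map.
Qed.

(** Linkedness of a concrete graph, as a finite check on its circuits. *)
Lemma coded_linked :
  (let cs := circuit_masks m s in let ks := iota 0 (size s) in
   all (fun k => all (fun l => has (fun b => nth false b k && nth false b l) cs) ks) ks) ->
  linked Z [set: edge G].
Proof.
move=> /allP lk e f _ _.
have range g : idx K g \in iota 0 (size s) by rewrite mem_iota idx_lt.
have /allP/(_ _ (range f))/hasP[b] := lk _ (range e).
case/circuit_masksP=> sb bc /andP[eb fb]; exists (edges_of b); split; rewrite ?subsetT ?inE //.
Qed.

End Coded.

End LinkLists.

(** * Graphs with at most eight vertices *)

Section SmallGraphs.
Implicit Types (x y : link) (s ps pre : seq link) (v m : nat) (d : seq nat).

Definition spend k x d :=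
  set_nth 0 (set_nth 0 d x.1 (nth 0 d x.1 - k)) x.2 (nth 0 d x.2 - k).

(** [explore] runs through the multiplicities of the links of [ps], given the degrees
[d] still to be filled and the largest label [top] reached so far, and tests [P] on
every completed graph.  A link to a new vertex must use the label [top.+1]: only
breadth-first labellings are produced. *)
Fixpoint explore (P : pred (seq link)) ps (top : nat) d s : bool :=
  if ps is x :: ps' then
    if has (predC1 0) (take x.1 d) then true else
    all (fun k => explore P ps' (if 0 < k then maxn top x.2 else top) (spend k x d)
                          (s ++ nseq k x))
        (iota 0 (if x.2 <= top.+1 then minn (nth 0 d x.1) (nth 0 d x.2) else 0).+1)
  else has (predC1 0) d || P s.

Lemma has_nonzero d : (forall v, nth 0 d v = 0) -> has (predC1 0) d = false.
Proof. by move=> d0; apply/negbTE/hasPn=> k /(nthP 0)[v _ <-]; rewrite d0. Qed.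

(** The multiplicities [mu] describe a path through the search.  The bound on a new
label holds because every smaller positive label ends an earlier link. *)
Lemma explore_complete (P : pred (seq link)) (mu : link -> nat) pre ps d s :
  (forall v, nth 0 d v = \sum_(x <- ps | meets v x) mu x) ->
  all (fun x => x.1 < x.2) ps -> sorted leq [seq x.1 | x <- ps] ->
  (forall pre' x post, pre ++ ps = pre' ++ x :: post -> 0 < mu x ->
     forall j, 0 < j < x.2 -> exists y, [/\ y \in pre', 0 < mu y & y.2 = j]) ->
  explore P ps (\max_(y <- pre | 0 < mu y) y.2) d s ->
  P (s ++ flatten [seq nseq (mu x) x | x <- ps]).
Proof.
elim: ps pre d s => [|x ps IH] pre d s dE lt12 srt bfs.
  by rewrite /= has_nonzero ?cats0 // => v; rewrite dE big_nil.
case/andP: lt12 => lt12 lts; rewrite [explore _ _ _ _ _]/explore -/explore.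
have xmin y : y \in ps -> x.1 <= y.1.
  by move=> yps; have /allP := order_path_min leq_trans srt; apply; apply: map_f.
rewrite ifF => [/allP expl|]; last first.
  apply: has_nonzero => v.
  have [le|gt] := leqP (size (take x.1 d)) v; first by rewrite nth_default.
  have vx : v < x.1 by rewrite (leq_trans gt) // size_take_min geq_minl.
  rewrite nth_take // dE big1_seq // => y /andP[+ yps]; rewrite /meets.
  have [le1 lt2] : x.1 <= y.1 /\ y.1 < y.2.
    by move: yps; rewrite inE => /orP[/eqP->//|yps]; rewrite xmin // (allP lts y).
  have vy := leq_trans vx le1; by rewrite (ltn_eqF vy) (ltn_eqF (ltn_trans vy lt2)).
have le1 : mu x <= nth 0 d x.1 by rewrite dE big_cons /meets eqxx leq_addr.
have le2 : mu x <= nth 0 d x.2 by rewrite dE big_cons /meets eqxx orbT leq_addr.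
rewrite catA; apply: (IH (rcons pre x) (spend (mu x) x d)) => //.
- move=> v; have := dE v; rewrite big_cons /spend !nth_set_nth /= nth_set_nth /= /meets.
  have [->|_] := eqVneq v x.2; first by rewrite orbT => ->; rewrite addKn.
  by have [->|_] := eqVneq v x.1; first by move=> ->; rewrite addKn.
- exact: path_sorted srt.
- by move=> pre' y post; rewrite cat_rcons; apply: bfs.
rewrite big_rcons /=; set top := \max_(y <- pre | _) _ in expl *.
have -> : maxn top (if 0 < mu x then x.2 else 0) = if 0 < mu x then maxn top x.2 else top.
  by case: ifP => // _; rewrite maxn0.
apply: expl; rewrite mem_iota add0n ltnS.
have [->//|mu0] := posnP (mu x); rewrite (_ : x.2 <= top.+1) ?leq_min ?le1 //.
case jE: x.2 => [//|[//|j]]; have [||y [ypre muy yj]] := bfs pre x ps _ mu0 j.+1 => //.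
  by rewrite jE ltnSn.
rewrite ltnS -yj /top; exact: (leq_bigmax_seq _ ypre muy).
Qed.

Section Bfs.
Variables (T : finType) (r : rel T) (x0 : T).
Hypothesis conn : forall t, connect r x0 t.

(** In a breadth-first order, when the vertex at place [i] sees the one at place [j], all
places before [j] have already been seen from places up to [i].  The order is built by
appending at stage [t] the unseen neighbours of the vertex at place [t]. *)
Lemma bfs_order : exists l : seq T,
  [/\ uniq l, forall t, t \in l &
    forall i j, i < j < size l -> r (nth x0 l i) (nth x0 l j) ->
    forall j', 0 < j' < j ->
      exists2 i', i' <= i /\ i' < j' & r (nth x0 l i') (nth x0 l j')].
Proof.
pose inv t (l : seq T) := [/\ uniq l, 0 < size l /\ nth x0 l 0 = x0,
  forall k w, k < t -> k < size l -> r (nth x0 l k) w -> w \in l,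
  forall j, 0 < j < size l -> exists2 i, i < t /\ i < j & r (nth x0 l i) (nth x0 l j) &
  forall i j, i < t -> i < j < size l -> r (nth x0 l i) (nth x0 l j) ->
    forall j', 0 < j' < j ->
      exists2 i', i' <= i /\ i' < j' & r (nth x0 l i') (nth x0 l j')].
have step t l : inv t l -> exists l', inv t.+1 l'.
  case=> ul [l0 lx0] cl par old; have [le_t|lt_t] := leqP (size l) t.
    exists l; split=> // [k w _ kl|j /par[i [lt1 lt2] rij]|i j _ ijl].
    - exact: cl (leq_trans kl le_t) kl.
    - by exists i => //; split=> //; apply: ltnW.
    have /andP[ij jl] := ijl; apply: old => //.
    exact: leq_trans (ltn_trans ij jl) le_t.
  (* the neighbours of the vertex at place t that are not in l yet *)
  pose new := [seq w <- enum T | r (nth x0 l t) w & w \notin l].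
  have ul' : uniq (l ++ new).
    rewrite cat_uniq ul filter_uniq ?enum_uniq // andbT; apply/hasPn=> w.
    by rewrite mem_filter => /andP[/andP[_ ]].
  have nthl k : k < size l -> nth x0 (l ++ new) k = nth x0 l k by move=> kl; rewrite nth_cat kl.
  have par' j : 0 < j < size (l ++ new) ->
      exists2 i, i < t.+1 /\ i < j & r (nth x0 (l ++ new) i) (nth x0 (l ++ new) j).
    case/andP=> j0; have [jl _|lj jl] := ltnP j (size l).
      have [|i [it ij] rij] := par j; first by rewrite j0.
      by exists i; [split=> //; apply: ltnW | rewrite !nthl // (ltn_trans ij)].
    exists t; first by split=> //; apply: leq_trans lj.
    rewrite nthl // nth_cat ltnNge lj /=.
    have : nth x0 new (j - size l) \in new.
      by rewrite mem_nth // ltn_subLR // -size_cat.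
    by rewrite mem_filter => /andP[/andP[]].
  have cl' k w : k < t.+1 -> k < size (l ++ new) -> r (nth x0 (l ++ new) k) w -> w \in l ++ new.
    rewrite ltnS leq_eqVlt => /orP[/eqP->|kt] _.
      by rewrite nthl // => rw; rewrite mem_cat mem_filter rw mem_enum andbT; case: (w \in l).
    have kl := ltn_trans kt lt_t.
    by rewrite nthl // => rkw; rewrite mem_cat (cl k).
  exists (l ++ new); split=> //.
    by split; [rewrite size_cat addn_gt0 l0 | rewrite nthl].
  move=> i j; rewrite ltnS leq_eqVlt => /orP[/eqP->|it] /andP[ij jl].
    move=> _ j' /andP[j'0 j'j]; have [|i' [i't i'j'] ri'] := par' j'.
      by rewrite j'0 (ltn_trans j'j).
    by exists i'.
  have il := ltn_trans it lt_t; rewrite nthl // => rij.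
  have jl' : j < size l.
    have wl := cl i _ it il rij; have jE := index_uniq x0 jl ul'.
    by rewrite -jE index_cat wl index_mem.
  move=> j' /andP[j'0 j'j]; have j'l := ltn_trans j'j jl'.
  have [|||i' [i'i i'j'] ri'] := old i j it _ _ j'; rewrite ?ij ?j'0 //; first by rewrite -(nthl j).
  by exists i' => //; rewrite !nthl // (ltn_trans i'j').
have [l [ul [l0 lx0] cl par bfs]] : exists l, inv #|T| l.
  elim: #|T| => [|t [l /step]//]; exists [:: x0]; split=> //.
  by move=> [|j].
have small k : k < size l -> k < #|T|.
  by move=> kl; rewrite (leq_trans kl) // -(card_uniqP ul) max_card.
exists l; split=> // [t|i j /andP[ij jl] rij j' j'j]; last first.
  by apply: bfs rij _ j'j; rewrite ?small ?ij //; apply: ltn_trans jl.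
have /connectP[p] := conn t; have : x0 \in l by rewrite -lx0 mem_nth.
elim: p x0 => [|z p IH] y yl /=; first by move=> _ ->.
case/andP=> yz pz tE; apply: IH pz tE.
have iy : index y l < size l by rewrite index_mem.
by apply: (cl (index y l)); rewrite ?small // nth_index.
Qed.
End Bfs.

Definition pairs m := [seq (i, j) | i <- iota 0 m, j <- iota i.+1 (m - i.+1)].

Lemma mem_pairs m x : (x \in pairs m) = (x.1 < x.2 < m).
Proof.
apply/allpairsPdep/idP => [[i [j []]]|/andP[lt12 lt2]].
  rewrite !mem_iota => /andP[_ im] /andP[ij jm] -> /=; rewrite ij /=.
  by rewrite subnKC in jm.
have lt1 := ltn_trans lt12 lt2.
exists x.1, x.2; split; rewrite ?mem_iota ?lt12 ?subnKC ?lt2 ?lt1 //; by case: (x).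
Qed.

(** The order in which [pairs] lists the links. *)
Definition lexlt x y := (x.1 < y.1) || (x.1 == y.1) && (x.2 < y.2).

(** Computed for all the sizes that occur. *)
Lemma pairs_facts m : m < 9 ->
  [&& pairwise lexlt (pairs m), sorted leq [seq x.1 | x <- pairs m] & uniq (pairs m)].
Proof. by move: m; do 9 case=> //. Qed.

Lemma all2_catl (S T : Type) (r : S -> T -> bool) (s1 s2 : seq S) (t1 t2 : seq T) : size s1 = size t1 ->
  all2 r (s1 ++ s2) (t1 ++ t2) = all2 r s1 t1 && all2 r s2 t2.
Proof. by elim: s1 t1 => [|a s1 IH] [|c t1] //= [/IH->]; rewrite andbA. Qed.

Section Presentation.
Variables (G : mgraph).
Hypotheses (cubicG : cubic G) (connG : is_connected (whole G)).
Local Notation m := #|vertex G|.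

(** Label the vertices in breadth-first order and list the edges by blocks of parallel
ones; the result is one of the graphs visited by [explore]. *)
Lemma coded_explore (P : pred (seq link)) : m < 9 ->
  explore P (pairs m) 0 (nseq m 3) [::] -> exists2 s, P s & inhabited (coded G m s).
Proof.
move=> m9 expl; have /and3P[plex psort puniq] := pairs_facts m9.
have [/set0Pn[v0 _] cl] := connectedP (is_subgraph_whole G) connG.
have conn t : connect (adj (whole G)) v0 t.
  suff : t \in [set w | connect (adj (whole G)) v0 w] by rewrite inE.
  rewrite (cl [set w | connect (adj (whole G)) v0 w]) ?inE ?subsetT //.
    by apply/set0Pn; exists v0; rewrite inE connect0.
  by move=> a b; rewrite !inE => va ab; apply: connect_trans va (connect1 ab).
have [l [ul all_l bfs]] := bfs_order conn.
have size_l : size l = m.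
  by rewrite -(card_uniqP ul); apply: eq_card => t; rewrite all_l.
pose at_ k := nth v0 l k.
have at_inj i j : i < m -> j < m -> (at_ i == at_ j) = (i == j).
  by move=> im jm; rewrite nth_uniq ?size_l.
pose block x := [seq e <- enum (edge G) | ends e == [set at_ x.1; at_ x.2]].
pose mu x := size (block x).
pose es := flatten [seq block x | x <- pairs m].
pose s := flatten [seq nseq (mu x) x | x <- pairs m].
have all2_es : all2 (fun e x => ends e == [set at_ x.1; at_ x.2]) es s.
  rewrite /es /s; elim: (pairs m) => //= x ps IH; rewrite all2_catl ?size_nseq // IH andbT.
  rewrite /mu; have : all (fun e => ends e == [set at_ x.1; at_ x.2]) (block x) by apply: filter_all.
  by elim: (block x) => //= e b IHb /andP[-> /IHb].
have size_es : size es = size s by move: all2_es; rewrite all2E => /andP[/eqP].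
have one e : exists2 x, x \in pairs m &
    {in pairs m, forall y, (ends e == [set at_ y.1; at_ y.2]) = (y == x)}.
  have /cards2P[a [b [ab eE]]] : #|ends e| == 2 by rewrite card_ends.
  wlog lt_ab : a b ab eE / index a l < index b l.
    move=> wl; case: (ltngtP (index a l) (index b l)) => [|lt|eq].
    - exact: wl ab eE.
    - by apply: (wl b a) => //; rewrite 1?eq_sym // setUC.
    - by case/eqP: ab; rewrite -(nth_index v0 (all_l a)) eq nth_index.
  have am : index a l < m by rewrite -size_l index_mem.
  have bm : index b l < m by rewrite -size_l index_mem.
  have [aE bE] : at_ (index a l) = a /\ at_ (index b l) = b by rewrite /at_ !nth_index.
  exists (index a l, index b l); first by rewrite mem_pairs lt_ab.
  move=> [i j]; rewrite mem_pairs /= => /andP[ij jm]; have im := ltn_trans ij jm.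
  rewrite xpair_eqE eE; apply/eqP/andP => [/setP eqS|[/eqP-> /eqP->]]; last by rewrite aE bE.
  have := eqS (at_ i); have := eqS (at_ j).
  rewrite !inE !eqxx orbT -aE -bE !at_inj // => /orP jab /orP iab.
  case: iab jab => /eqP iE [] /eqP jE; rewrite iE jE aE bE ?eqxx //;
    move: ij lt_ab; rewrite iE jE ?ltnn // => lt1 lt2.
  by have := ltn_trans lt1 lt2; rewrite ltnn.
have count_es e : count_mem e es = 1.
  have [x xm xE] := one e.
  rewrite count_flatten -map_comp.
  have -> : sumn [seq (count_mem e \o block) x | x <- pairs m]
          = count (fun y => ends e == [set at_ y.1; at_ y.2]) (pairs m).
    elim: (pairs m) => //= y ps ->; congr (_ + _).
    rewrite (count_uniq_mem _ (filter_uniq _ (enum_uniq _))) mem_filter mem_enum andbT //.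
  by rewrite (eq_in_count xE) count_uniq_mem // xm.
have mem_es e : e \in es by rewrite -has_pred1 has_count count_es.
have uniq_es : uniq es by apply: count_mem_uniq => e; rewrite count_es mem_es.
have count_esE (Q : pred (edge G)) : count Q es = #|Q|.
  rewrite cardE /enum_mem size_filter -enumT; apply/seq.permP/uniq_perm => //.
    exact: enum_uniq.
  by move=> e; rewrite mem_es mem_enum.
have ends_idx e : ends e = [set at_ (nth (0, 0) s (index e es)).1; at_ (nth (0, 0) s (index e es)).2].
  apply/eqP; have := all2_es; rewrite all2E => /andP[_ /(all_nthP (e, (0, 0)))].
  have le : index e es < size es by rewrite index_mem.
  move=> /(_ (index e es)); rewrite size_zip -size_es minnn => /(_ le).
  by rewrite nth_zip //= nth_index.
have s_pairs x : x \in s -> x \in pairs m.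
  by case/flatten_mapP=> y ym; rewrite mem_nseq => /andP[_ /eqP->].
have mu_adj x : x \in pairs m -> (0 < mu x) = adj (whole G) (at_ x.1) (at_ x.2).
  move=> xm; rewrite /mu /block size_filter -has_count.
  apply/hasP/adjE => [[e _ /eqP eE]|[e _ eE]]; first by exists e; rewrite ?inE.
  by exists e; rewrite ?mem_enum ?eE.
have Ps : P s.
  apply: (explore_complete (mu := mu) (pre := [::]) (d := nseq m 3) (s := [::])) => //.
  - move=> v; rewrite nth_nseq; case: ifP => [vm|/negbT vm]; last first.
      rewrite big1_seq // => x /andP[+ xm]; move: xm; rewrite mem_pairs /meets -leqNgt in vm *.
      case/andP=> lt12 lt2; rewrite !gtn_eqF //; first exact: leq_trans lt2 vm.
      exact: leq_trans (ltn_trans lt12 lt2) vm.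
    have -> : 3 = count (fun e => at_ v \in ends e) es.
      by rewrite count_esE -(deg3 cubicG (at_ v)); apply: eq_card => e; rewrite !inE.
    rewrite count_flatten sumnE !big_map.
    rewrite [RHS]big_mkcond /=; apply: eq_big_seq => x xm.
    rewrite (eq_in_count (a2 := fun=> meets v x)).
      by case: (meets v x); rewrite ?count_predT ?count_pred0.
    move: xm; rewrite mem_pairs => /andP[lt12 lt2] e.
    rewrite mem_filter => /andP[/eqP eE _]; rewrite eE !inE !at_inj //.
    exact: ltn_trans lt2.
  - by apply/allP=> x; rewrite mem_pairs => /andP[].
  - move=> pre x post /= defL mu0 j /andP[j0 jx].
    have xm : x \in pairs m by rewrite defL mem_cat mem_head orbT.
    have := xm; rewrite mem_pairs => /andP[lt12 lt2].
    have [|||i' [i'x i'j] ri'] := bfs x.1 x.2 _ _ j; rewrite ?size_l ?lt12 ?j0 //.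
      by rewrite -mu_adj.
    have ym : (i', j) \in pairs m by rewrite mem_pairs /= i'j (ltn_trans jx).
    exists (i', j); split; rewrite ?mu_adj //.
    have lex : lexlt (i', j) x.
      by rewrite /lexlt /= jx andbT orbC -leq_eqVlt.
    move: ym plex; rewrite defL mem_cat pairwise_cat => /orP[//|+ /and3P[_ _]].
    rewrite inE /= => /orP[/eqP yx|yp /andP[/allP/(_ _ yp)]].
      by move: jx; rewrite -yx ltnn.
    move: lex; rewrite /lexlt /= => /orP[lt|/andP[/eqP-> lt]].
      by rewrite ltnNge (ltnW lt) (gtn_eqF lt).
    by rewrite ltnn eqxx ltnNge (ltnW lt).
  - by rewrite big_nil.
exists s => //; constructor.
refine (@Coded G m s (fun u => index u l) (fun e => index e es) _ _ _ _ _ _ _) => //.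
- by move=> a b eqi; rewrite -(nth_index v0 (all_l a)) eqi nth_index.
- by move=> v; rewrite -size_l index_mem.
- by move=> a b eqi; rewrite -(nth_index a (mem_es a)) eqi nth_index.
- by move=> e; rewrite -size_es index_mem.
- by rewrite -size_es -(card_uniqP uniq_es); apply: eq_card => e; rewrite mem_es.
move=> e v; rewrite {1}ends_idx; set x := nth _ _ _.
have xm : x \in pairs m by apply/s_pairs/mem_nth; rewrite -size_es index_mem.
move: xm; rewrite mem_pairs => /andP[lt12 lt2]; have lt1 := ltn_trans lt12 lt2.
have vm : index v l < m by rewrite -size_l index_mem.
by rewrite !inE /meets -!at_inj // /at_ nth_index.
Qed.

End Presentation.

Lemma card_edges (G : mgraph) : cubic G -> 2 * #|edge G| = 3 * #|vertex G|.
Proof.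
move=> cubicG.
have sumE : \sum_(e : edge G) \sum_(u | u \in ends e) 1 = 2 * #|edge G|.
  rewrite mulnC -sum_nat_const; apply: eq_bigr => e _.
  by rewrite sum1_card card_ends.
have sumV : \sum_(u : vertex G) \sum_(e | u \in ends e) 1 = 3 * #|vertex G|.
  rewrite mulnC -sum_nat_const; apply: eq_bigr => u _.
  by rewrite sum1_card -(deg3 cubicG u) cardsE.
by rewrite -sumE -sumV (exchange_big_dep xpredT).
Qed.

Lemma card_vertices_even (G : mgraph) : cubic G -> ~~ odd #|vertex G|.
Proof.
by move/card_edges/(congr1 odd); rewrite !oddM /= => <-.
Qed.

Lemma card_vertices_gt0 (G : mgraph) : inseparable G -> 0 < #|vertex G|.
Proof.
case/andP=> /(connectedP (is_subgraph_whole G))[/set0Pn[v _] _] _.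
by apply/card_gt0P; exists v.
Qed.

(** With [3k] edges on [2k] vertices the cycle space has at least [2 ^ (k + 1)]
elements. *)
Lemma ncycles_lower_bound (G : mgraph) k : inseparable G -> cubic G ->
  #|vertex G| = k.*2 -> 'C(k.+2, 2) <= ncycles G.
Proof.
move=> insG cubG cV; rewrite ncycles_circuits //.
apply: linked_lower_bound; [exact: cycle_space0|exact: cycle_spaceD|exact: inseparable_linked|].
have /andP[connG _] := insG.
have [/set0Pn[v0 _] _] := connectedP (is_subgraph_whole G) connG.
have cE : #|edge G| = 3 * k.
  by have := card_edges cubG; rewrite cV -mul2n mulnCA => /eqP; rewrite eqn_pmul2l // => /eqP.
(* 3k edges against 2k - 1 independent boundary conditions *)
have := card_cycle_space v0; rewrite cE cV; have : 0 < #|vertex G| by apply/card_gt0P; exists v0.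
rewrite cV; case: k {cV cE} => // k _.
have -> : 3 * k.+1 = (k.+1.*2).-1 + k.+2 by rewrite -addnn mulnSr; lia.
by rewrite expnD leq_pmul2l // expn_gt0.
Qed.

(** What is needed on top of the lower bounds 3, 6, 10 and 15. *)
Definition small_spectrum m c :=
  if m <= 2 then c <= 3 else if m <= 4 then c <= 7 else (c != 13) && (c != 16).

Lemma explore_small : all (fun m =>
   explore (fun s => valid m s && small_spectrum m (size (circuit_masks m s))) (pairs m) 0 (nseq m 3) [::])
  [:: 2; 4; 6; 8].
Proof. by vm_compute. Qed.

Lemma ncycles_small (G : mgraph) : inseparable G -> cubic G -> #|vertex G| < 9 ->
  small_spectrum #|vertex G| (ncycles G).
Proof.
move=> insG cubG m9; have /andP[connG _] := insG.
have mE : #|vertex G| \in [:: 2; 4; 6; 8].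
  have := card_vertices_even cubG; have := card_vertices_gt0 insG.
  by move: #|vertex G| m9; do 9 case=> //.
have [s /andP[vs spec] [K]] := coded_explore cubG connG m9 (allP explore_small _ mE).
rewrite ncycles_circuits // (eq_card (B := [set C | circuit (cycle_space G) C && predT C])).
  by rewrite (@card_circuits _ _ _ K vs predT predT) // count_predT.
by move=> C; rewrite !inE andbT.
Qed.

Theorem ncycles_neq (G : mgraph) : inseparable G -> cubic G ->
  ncycles G \notin [:: 1; 2; 4; 5; 8; 9; 13; 16].
Proof.
move=> insG cubG; have evV := card_vertices_even cubG.
have := ncycles_lower_bound insG cubG (k := #|vertex G|./2).
rewrite -{1}(odd_double_half #|vertex G|) (negbTE evV) => /(_ (erefl _)).
have [m9|m9] := ltnP #|vertex G| 9; last first.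
  have : 6 < (#|vertex G|./2).+2 by rewrite 2!ltnS; have := half_leq m9; lia.
  move=> /(leq_bin2l 2)/leq_trans h /h; move: (ncycles G) => n.
  by do 17 (case: n => [|n] //).
have := ncycles_small insG cubG m9; have := card_vertices_gt0 insG.
move: #|vertex G| (ncycles G) m9 evV => m n m9.
case: m m9 => [|[|[|[|[|[|[|[|[|m]]]]]]]]] //= _ _ _;
  by do 17 (case: n => [|n] //).
Qed.

End SmallGraphs.

(** * Two-sums of drawn graphs *)

(** A two-page layout: vertices at distinct places on a line, each edge an arc above
([up]) or below the line. *)
Record arcs (G : mgraph) := Arcs {
  src : edge G -> vertex G;
  tgt : edge G -> vertex G;
  place : vertex G -> nat;
  up : edge G -> bool;
  place_inj : injective place;
  src_lt_tgt : forall e, place (src e) < place (tgt e);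
  ends_arc : forall e, ends e = [set src e; tgt e] }.

(** Two arcs on the same side cross when their ends interlace, and coincide when they
have the same ends. *)
Definition conflict (a b c d : nat) : bool :=
  [|| [&& a < c, c < b & b < d], [&& c < a, a < d & d < b] | (a == c) && (b == d)].

Definition clear G (A : arcs G) (x y : edge G) : bool :=
  (up A x == up A y) ==>
  ~~ conflict (place A (src A x)) (place A (tgt A x)) (place A (src A y)) (place A (tgt A y)).

(** The edge [e] is exempt: it is meant to be [outer], and in the final drawing it gets
a higher arc than the others, which leaves room for a triple edge. *)
Definition noncrossing G (A : arcs G) e :=
  forall x y, x != y -> x != e -> y != e -> clear A x y.

Definition outer G (A : arcs G) e :=
  [/\ up A e, place A (src A e) = 0 & forall v, place A v <= place A (tgt A e)].

Lemma src_neq_tgt G (A : arcs G) e : src A e != tgt A e.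
Proof. by apply/eqP=> eq; have := src_lt_tgt A e; rewrite eq ltnn. Qed.

Lemma mem_ends_arc G (A : arcs G) e v : (v \in ends e) = (v == src A e) || (v == tgt A e).
Proof. by rewrite (ends_arc A) !inE. Qed.

Section TwoSum.
Variables (G H : mgraph) (A : arcs G) (B : arcs H) (e : edge G) (f : edge H).
Local Notation V := (vertex G + vertex H)%type.
Local Notation E := (edge G + edge H)%type.

(** The edge names of both graphs survive: [e] now joins the first end of [f] to the
first end of [e], and [f] joins the two last ends. *)
Definition sum_src (z : E) : V :=
  match z with
  | inl x => if x == e then inr (src B f) else inl (src A x)
  | inr y => if y == f then inl (tgt A e) else inr (src B y)
  end.

Definition sum_tgt (z : E) : V :=
  match z with
  | inl x => if x == e then inl (src A e) else inl (tgt A x)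
  | inr y => if y == f then inr (tgt B f) else inr (tgt B y)
  end.

Definition sum_ends (z : E) : {set V} := [set sum_src z; sum_tgt z].

Lemma card_sum_ends z : #|sum_ends z| = 2.
Proof.
rewrite cards2; case: z => [x|y] /=.
  by case: (x =P e) => //= _; rewrite [_ == _](inj_eq inl_inj) src_neq_tgt.
by case: (y =P f) => //= _; rewrite [_ == _](inj_eq inr_inj) src_neq_tgt.
Qed.

Definition two_sum : mgraph := MGraph card_sum_ends.
Local Notation S := two_sum.

Implicit Types (X Y : {set edge S}).
Definition lpart X : {set edge G} := [set x | (inl x : E) \in X].
Definition rpart X : {set edge H} := [set y | (inr y : E) \in X].

Lemma card_sum_nat (T : finType) (X : {set T}) (P : pred T) :
  #|[set z in X | P z]| = \sum_z ((z \in X) && P z).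
Proof.
rewrite -sum1_card big_mkcond; apply: eq_bigr => z _; rewrite inE.
by case: (_ && _).
Qed.

(** At a vertex of [G] only the last end of [e] notices the change: there [f] has taken
the place of [e]. *)
Lemma deg_lpart X (w : vertex G) :
  #|[set z in X | (inl w : vertex S) \in ends z]| + ((w == tgt A e) && (e \in lpart X)) =
  #|[set x in lpart X | w \in ends x]| + ((w == tgt A e) && (f \in rpart X)).
Proof.
rewrite !card_sum_nat big_sumType /= (bigD1 e) //= [in RHS](bigD1 e) //=.
rewrite [X in _ + X + _ = _](bigD1 f) //=.
rewrite [X in _ + (_ + X) + _ = _]big1 => [|y /negbTE yf]; last first.
  by rewrite !inE /= yf /= andbF.
have eqs (a b : vertex G) : (inl a == inl b :> V) = (a == b) by exact: inj_eq inl_inj _ _.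
have eqd (a : vertex G) (b : vertex H) : (inl a == inr b :> V) = false by [].
rewrite (mem_ends_arc A) !inE /= !eqxx /= !eqs !eqd.
have -> : \sum_(i | i != e) (((inl i : edge S) \in X) && ((inl w : vertex S) \in sum_ends (inl i)))
  = \sum_(i | i != e) ((i \in lpart X) && (w \in ends i)).
  apply: eq_bigr => i /negbTE ie; rewrite (mem_ends_arc A) !inE /= ie.
  by rewrite !eqs.
have ne := src_neq_tgt A e.
have [->|_] := eqVneq w (src A e); first by rewrite (negbTE ne) !orbF !andbT !andbF /=; lia.
by have [->|_] := eqVneq w (tgt A e); rewrite ?orbT ?andbT ?andbF ?addn0 /=; lia.
Qed.

Lemma deg_rpart X (w : vertex H) :
  #|[set z in X | (inr w : vertex S) \in ends z]| + ((w == src B f) && (f \in rpart X)) =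
  #|[set y in rpart X | w \in ends y]| + ((w == src B f) && (e \in lpart X)).
Proof.
rewrite !card_sum_nat big_sumType /= (bigD1 e) //= [in RHS](bigD1 f) //=.
rewrite [X in _ + X + _ = _](bigD1 f) //=.
rewrite [X in _ + X + _ + _ = _]big1 => [|x /negbTE xe]; last first.
  by rewrite !inE /= xe /= andbF.
have eqs (a b : vertex H) : (inr a == inr b :> V) = (a == b) by exact: inj_eq inr_inj _ _.
have eqd (a : vertex H) (b : vertex G) : (inr a == inl b :> V) = false by [].
rewrite (mem_ends_arc B) !inE /= !eqxx /= !eqs !eqd.
have -> : \sum_(i | i != f) (((inr i : edge S) \in X) && ((inr w : vertex S) \in sum_ends (inr i)))
  = \sum_(i | i != f) ((i \in rpart X) && (w \in ends i)).
  apply: eq_bigr => i /negbTE iff; rewrite (mem_ends_arc B) !inE /= iff.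
  by rewrite !eqs.
have ne := src_neq_tgt B f.
have [->|_] := eqVneq w (src B f); first by rewrite (negbTE ne) !orbF !andbT /=; lia.
by have [->|_] := eqVneq w (tgt B f); rewrite ?orbT ?andbT ?andbF ?addn0 /=; lia.
Qed.

Lemma cubic_two_sum : cubic G -> cubic H -> cubic S.
Proof.
move=> cG cH; apply/forallP=> -[w|w]; rewrite /degree /= -/(ends _).
  have := deg_lpart [set: edge S] w; rewrite !inE => /addIn ->.
  by rewrite -(deg3 cG w); apply/eqP/eq_card => x; rewrite !inE.
have := deg_rpart [set: edge S] w; rewrite !inE => /addIn ->.
by rewrite -(deg3 cH w); apply/eqP/eq_card => x; rewrite !inE.
Qed.

(** If [e] and [f] disagreed, the boundary of the part in [G] would be a single vertex. *)
Lemma two_sum_space X : (X \in cycle_space S) =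
  [&& lpart X \in cycle_space G, rpart X \in cycle_space H & (e \in lpart X) == (f \in rpart X)].
Proof.
apply/cycle_spaceP/and3P => [evX|[/cycle_spaceP evL /cycle_spaceP evR /eqP ef] [w|w]].
- have ef : (e \in lpart X) = (f \in rpart X).
    apply/eqP/negPn/negP=> ne; suff bdE : bd (lpart X) = [set tgt A e].
      by have := odd_bd (lpart X); rewrite bdE cards1.
    apply/setP=> w; rewrite in_bd [RHS]inE.
    have := congr1 odd (deg_lpart X w); rewrite !oddD (negbTE (evX _)) !oddb.
    by move: ne; case: (e \in _); case: (f \in _); case: (w == _); case: (odd _).
  split; rewrite ?ef //; apply/cycle_spaceP=> w.
    by have := evX (inl w); have /eqP := deg_lpart X w; rewrite ef eqn_add2r => /eqP->.
  by have := evX (inr w); have /eqP := deg_rpart X w; rewrite ef eqn_add2r => /eqP->.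
- by have /eqP := deg_lpart X w; rewrite ef eqn_add2r => /eqP->.
by have /eqP := deg_rpart X w; rewrite ef eqn_add2r => /eqP->.
Qed.

Definition glue (p : {set edge G} * {set edge H}) : {set edge S} :=
  [set z | match z with inl x => x \in p.1 | inr y => y \in p.2 end].

Lemma lpart_glue p : lpart (glue p) = p.1.
Proof. by apply/setP=> x; rewrite !inE. Qed.

Lemma rpart_glue p : rpart (glue p) = p.2.
Proof. by apply/setP=> x; rewrite !inE. Qed.

Lemma partsK X : glue (lpart X, rpart X) = X.
Proof. by apply/setP=> -[x|x]; rewrite !inE. Qed.

Lemma parts_sub X Y : (X \subset Y) = (lpart X \subset lpart Y) && (rpart X \subset rpart Y).
Proof.
apply/subsetP/andP => [sub|[/subsetP subl /subsetP subr] [x|x] xX].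
- by split; apply/subsetP=> x; rewrite !inE; apply: sub.
- by have := subl x; rewrite !inE; apply.
by have := subr x; rewrite !inE; apply.
Qed.

Lemma lpart0 : lpart set0 = set0.
Proof. by apply/setP=> x; rewrite !inE. Qed.

Lemma rpart0 : rpart set0 = set0.
Proof. by apply/setP=> x; rewrite !inE. Qed.

Lemma glue0 : glue (set0, set0) = set0.
Proof. by apply/setP=> -[x|x]; rewrite !inE. Qed.

Local Notation ZG := (cycle_space G).
Local Notation ZH := (cycle_space H).

(** The circuits are those on one side that avoid the cut edge, and the unions of a
circuit through [e] with a circuit through [f]. *)
Lemma circuit_two_sum X : circuit (cycle_space S) X =
  [|| [&& circuit ZG (lpart X), e \notin lpart X & rpart X == set0],
      [&& lpart X == set0, circuit ZH (rpart X) & f \notin rpart X] |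
      [&& circuit ZG (lpart X), e \in lpart X, circuit ZH (rpart X) & f \in rpart X]].
Proof.
have ZG0 := cycle_space0 G; have ZH0 := cycle_space0 H.
apply/idP/idP.
  case/circuitP; rewrite two_sum_space => /and3P[LZ RZ /eqP ef] X0 minX.
  have minLR (Y1 : {set edge G}) (Y2 : {set edge H}) : Y1 \in ZG -> Y2 \in ZH -> (e \in Y1) = (f \in Y2) ->
     Y1 \subset lpart X -> Y2 \subset rpart X -> (Y1 != set0) || (Y2 != set0) ->
     Y1 = lpart X /\ Y2 = rpart X.
    move=> Z1 Z2 ef12 s1 s2 n0; suff <- : glue (Y1, Y2) = X by rewrite lpart_glue rpart_glue.
    apply: minX.
    - by rewrite two_sum_space lpart_glue rpart_glue /= Z1 Z2 ef12 eqxx.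
    - by rewrite parts_sub lpart_glue rpart_glue s1.
    apply: contraTneq n0 => eq0; have := lpart_glue (Y1, Y2); have := rpart_glue (Y1, Y2).
    by rewrite eq0 lpart0 rpart0 /= => <- <-; rewrite !eqxx.
  case eL: (e \in lpart X).
    apply/or3P/Or33; rewrite -ef eL andbT /=; apply/andP; split.
      apply/circuitP; split=> // [|Y YZ YL Y0]; first by apply/set0Pn; exists e.
      case eY: (e \in Y).
        by have [||//] := minLR Y _ YZ RZ _ YL (subxx _); rewrite ?eY -?ef ?Y0.
      by have [||//] := minLR Y _ YZ ZH0 _ YL (sub0set _); rewrite ?inE ?Y0.
    apply/circuitP; split=> // [|Y YZ YL Y0]; first by apply/set0Pn; exists f; rewrite -ef.
    case fY: (f \in Y).
      by have [||//] := minLR _ Y LZ YZ _ (subxx _) YL; rewrite ?fY ?eL ?Y0 ?orbT.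
    by have [||//] := minLR _ Y ZG0 YZ _ (sub0set _) YL; rewrite ?inE ?fY ?Y0 ?orbT.
  have [L0|L0] := eqVneq (lpart X) set0.
    apply/or3P/Or32; rewrite -ef eL andbT /=.
    apply/circuitP; split=> // [|Y YZ YL Y0].
      by apply: contraNneq X0 => R0; rewrite -(partsK X) L0 R0 glue0.
    have [||//] := minLR _ Y ZG0 YZ _ (sub0set _) YL; rewrite ?inE ?Y0 ?orbT //.
    apply/esym/negP=> /(subsetP YL); by rewrite -ef eL.
  have [||_ R0] := minLR _ _ LZ ZH0 _ (subxx _) (sub0set _); rewrite ?in_set0 ?eL ?L0 //.
  rewrite -R0 eqxx /= andbT; apply/orP; left.
  apply/circuitP; split=> // Y YZ YL Y0.
  have [||//] := minLR Y _ YZ ZH0 _ YL (sub0set _); rewrite ?inE ?Y0 //.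
  by apply/negP=> /(subsetP YL); rewrite eL.
have nonempty : (lpart X != set0) || (rpart X != set0) -> X != set0.
  by apply: contraTneq => ->; rewrite lpart0 rpart0 !eqxx.
have split0 Y : Y != set0 -> (lpart Y != set0) || (rpart Y != set0).
  rewrite -negb_and; apply: contra => /andP[/eqP L0 /eqP R0].
  by rewrite -(partsK Y) L0 R0 glue0.
case/or3P.
- case/and3P=> /circuitP[LZ L0 minL] eL /eqP R0; apply/circuitP; split.
  + by rewrite two_sum_space LZ R0 ZH0 in_set0 (negbTE eL).
  + by rewrite nonempty ?L0.
  move=> Y; rewrite two_sum_space parts_sub R0 subset0 => /and3P[YL YR _] /andP[sL /eqP Y0].
  move=> /split0; rewrite Y0 eqxx orbF => /(minL _ YL sL) YLE.
  by rewrite -(partsK Y) YLE Y0 -R0 partsK.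
- case/and3P=> /eqP L0 /circuitP[RZ R0 minR] fR; apply/circuitP; split.
  + by rewrite two_sum_space RZ L0 ZG0 in_set0 (negbTE fR).
  + by rewrite nonempty ?R0 ?orbT.
  move=> Y; rewrite two_sum_space parts_sub L0 subset0 => /and3P[YL YR _] /andP[/eqP Y0 sR].
  move=> /split0; rewrite Y0 eqxx => /(minR _ YR sR) YRE.
  by rewrite -(partsK Y) YRE Y0 -L0 partsK.
case/and4P=> /circuitP[LZ L0 minL] eL /circuitP[RZ R0 minR] fR; apply/circuitP; split.
- by rewrite two_sum_space LZ RZ eL fR.
- by rewrite nonempty ?L0.
move=> Y; rewrite two_sum_space parts_sub => /and3P[YL YR /eqP ef] /andP[sL sR].
move=> /split0 Y0; suff [LE RE] : lpart Y = lpart X /\ rpart Y = rpart X.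
  by rewrite -(partsK Y) LE RE partsK.
have [fYR eYL] : (lpart Y != set0 -> f \in rpart Y) /\ (rpart Y != set0 -> e \in lpart Y).
  by split=> [/(minL _ YL sL)|/(minR _ YR sR)]; [rewrite -ef|rewrite ef] => ->.
have neL : lpart Y != set0.
  case/orP: Y0 => // /eYL eY; by apply/set0Pn; exists e.
have neR : rpart Y != set0 by apply/set0Pn; exists f; apply: fYR.
by rewrite (minL _ YL sL neL) (minR _ YR sR neR).
Qed.

(** [Q] selects by the part in [H]; it serves to count the circuits through or off a new
outer edge, which lies in [H]. *)
Lemma card_circuits_two_sum (Q : pred {set edge H}) :
  #|[set X | circuit (cycle_space S) X && Q (rpart X)]| =
  Q set0 * #|[set C | circuit ZG C && (e \notin C)]| +
  #|[set C | circuit ZH C && ((f \notin C) && Q C)]| +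
  #|[set C | circuit ZG C && (e \in C)]| *
  #|[set C | circuit ZH C && ((f \in C) && Q C)]|.
Proof.
pose parts X := (lpart X, rpart X).
have parts_inj : injective parts by move=> X Y /(congr1 glue); rewrite !partsK.
set A0 := [set C | circuit ZG C && (e \notin C)].
set A1 := [set C | circuit ZG C && (e \in C)].
set B0 := [set C | circuit ZH C && ((f \notin C) && Q C)].
set B1 := [set C | circuit ZH C && ((f \in C) && Q C)].
pose A0' := if Q set0 then A0 else set0.
have -> : Q set0 * #|A0| = #|A0'| by rewrite /A0'; case: (Q set0); rewrite ?mul1n ?cards0.
rewrite -(card_imset _ parts_inj).
have -> : parts @: [set X | circuit (cycle_space S) X && Q (rpart X)] =
   setX A0' [set set0] :|: setX [set set0] B0 :|: setX A1 B1.
  apply/setP=> -[C D]; rewrite !inE /=; apply/imsetP/idP.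
    case=> X; rewrite inE circuit_two_sum => /andP[+ QX] [-> ->].
    case/or3P => [/and3P[cL eL /eqP R0]|/and3P[/eqP L0 cR fR]|/and4P[-> -> -> ->]].
    - by rewrite /A0' -R0 QX inE cL eL R0 eqxx.
    - by rewrite L0 eqxx cR fR QX orbT.
    - by rewrite QX orbT.
  move=> CD; exists (glue (C, D)); last by rewrite /parts lpart_glue rpart_glue.
  rewrite inE circuit_two_sum lpart_glue rpart_glue /=.
  move: CD => /orP[/orP[/andP[CA /eqP->]|/andP[/eqP-> /and3P[-> -> ->]]]|].
  - by move: CA; rewrite /A0'; case: ifP => QD; rewrite inE // => /andP[-> ->]; rewrite eqxx.
  - by rewrite eqxx orbT.
  - by case/andP=> /andP[-> ->] /and3P[-> -> ->]; rewrite !orbT.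
have nA C : C \in A0' -> C != set0.
  by rewrite /A0'; case: ifP; rewrite inE // => _ /andP[/circuitP[]].
have nA1 C : C \in A1 -> C != set0 by rewrite inE => /andP[/circuitP[]].
have nB0 C : C \in B0 -> C != set0 by rewrite inE => /andP[/circuitP[]].
have nB1 C : C \in B1 -> C != set0 by rewrite inE => /andP[/circuitP[]].
rewrite !cardsU !disjoint_setI0 ?cards0 ?subn0 ?cardsX ?cards1 ?muln1 ?mul1n //.
  rewrite -setI_eq0; apply/eqP/setP=> -[C D]; rewrite in_setI in_setU !in_setX in_set0 !in_set1 /=.
  apply/negP=> /andP[+ /andP[/nA1 C0 /nB1 D0]].
  by rewrite (negbTE C0) (negbTE D0) andbF.
rewrite -setI_eq0; apply/eqP/setP=> -[C D]; rewrite in_setI !in_setX in_set0 !in_set1 /=.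
by apply/negP=> /andP[/andP[/nA C0 _] /andP[/eqP CE _]]; rewrite CE eqxx in C0.
Qed.

Lemma linked_two_sum : linked ZG [set: edge G] -> linked ZH [set: edge H] ->
  linked (cycle_space S) [set: edge S].
Proof.
move=> lG lH.
have jG x y : exists C, [/\ circuit ZG C, x \in C & y \in C].
  by have [C [? _ ? ?]] := lG x y (in_setT _) (in_setT _); exists C.
have jH x y : exists C, [/\ circuit ZH C, x \in C & y \in C].
  by have [C [? _ ? ?]] := lH x y (in_setT _) (in_setT _); exists C.
have through C D : circuit ZG C -> e \in C -> circuit ZH D -> f \in D ->
    circuit (cycle_space S) (glue (C, D)).
  by move=> cC eC cD fD; rewrite circuit_two_sum lpart_glue rpart_glue cC eC cD fD !orbT.
have memg C D z : (z \in glue (C, D)) = match z with inl x => x \in C | inr y => y \in D end.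
  by rewrite inE.
have cross x y : joined (cycle_space S) [set: edge S] (inl x) (inr y).
  have [C [cC xC eC]] := jG x e; have [D [cD yD fD]] := jH y f.
  by exists (glue (C, D)); rewrite through // subsetT !memg.
move=> [x|x] [y|y] _ _.
- have [C [cC xC yC]] := jG x y; case eC: (e \in C).
    by have [D [cD fD _]] := jH f f; exists (glue (C, D)); rewrite through // subsetT !memg.
  exists (glue (C, set0)); rewrite subsetT !memg; split=> //.
  by rewrite circuit_two_sum lpart_glue rpart_glue /= cC eC eqxx.
- exact: cross.
- by apply: joined_sym; apply: cross.
have [D [cD xD yD]] := jH x y; case fD: (f \in D).
  by have [C [cC eC _]] := jG e e; exists (glue (C, D)); rewrite through // subsetT !memg.
exists (glue (set0, D)); rewrite subsetT !memg; split=> //.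
by rewrite circuit_two_sum lpart_glue rpart_glue /= cD fD eqxx orbT.
Qed.

(** The layout of [G] is inserted immediately after the place [k] of the first end of
[f]; [N] is the room it takes. *)
Hypothesis outer_e : outer A e.
Let N := (place A (tgt A e)).+1.
Let k := place B (src B f).

Definition sum_place (z : V) : nat :=
  match z with
  | inl w => k.+1 + place A w
  | inr w => if place B w <= k then place B w else place B w + N
  end.

Lemma sum_place_inj : injective sum_place.
Proof.
have [_ _ top] := outer_e.
move=> [a|a] [b|b] /=.
- by move=> eq; congr inl; apply: (place_inj (a := A)); lia.
- by move=> eq; exfalso; move: eq (top a); rewrite /N; case: leqP; lia.
- by move=> eq; exfalso; move: eq (top b); rewrite /N; case: leqP; lia.
by case: leqP => ha; case: leqP => hb eq; congr inr; apply: (place_inj (a := B)); lia.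
Qed.

Lemma sum_src_lt_tgt z : sum_place (sum_src z) < sum_place (sum_tgt z).
Proof.
have [_ src0 top] := outer_e.
case: z => [x|y] /=; case: eqP => _ /=.
- by rewrite leqnn src0 -/k; lia.
- by have := src_lt_tgt A x; lia.
- by have := src_lt_tgt B f; rewrite -/k /N; case: (leqP (place B (tgt B f)) k); lia.
have := src_lt_tgt B y.
by case: (leqP (place B (src B y)) k); case: (leqP (place B (tgt B y)) k); lia.
Qed.

Definition sum_up (z : E) : bool :=
  match z with inl x => if x == e then true else up A x | inr y => up B y end.

Definition sum_arcs : arcs S :=
  @Arcs S sum_src sum_tgt sum_place sum_up sum_place_inj sum_src_lt_tgt (fun=> erefl).

(** The edge [f] shrinks to an arc from the last vertex of the inserted block, that is
from just after [k], to its old end.  Doubling all places makes room for this point,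
and [ncf] says that the shrunk arc crosses nothing. *)
Variable g : edge H.
Hypothesis ncA : noncrossing A e.
Hypothesis ncB : forall x y, x != y -> x != f -> y != f -> x != g -> y != g -> clear B x y.
Hypothesis ncf : forall y, y != f -> y != g -> up B y = up B f ->
  ~~ conflict (place B (src B y)).*2 (place B (tgt B y)).*2 k.*2.+1 (place B (tgt B f)).*2.

Lemma conflictC a b c d : conflict a b c d = conflict c d a b.
Proof. by rewrite /conflict; apply/idP/idP; lia. Qed.

Lemma clearC G0 (A0 : arcs G0) x y : clear A0 x y = clear A0 y x.
Proof. by rewrite /clear eq_sym conflictC. Qed.

Lemma sum_noncrossing : noncrossing sum_arcs (inr g).
Proof.
have [_ src0 top] := outer_e.
have lr x y : clear sum_arcs (inl x) (inr y).
  rewrite /clear; apply/implyP => _ /=; have := src_lt_tgt B y; have := src_lt_tgt B f.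
  rewrite -/k; have := top (src A x); have := top (tgt A x); have := src_lt_tgt A x.
  rewrite /conflict /N; case: (x == e) => /=; case: (y =P f) => [->|_] /=;
   rewrite -/k ?leqnn ?src0; try case: (leqP (place B (src B y)) k);
   try case: (leqP (place B (tgt B y)) k); try case: (leqP (place B (tgt B f)) k); lia.
move=> [x|x] [y|y] xy; [move=> _ _ | move=> _ _; exact: lr | by rewrite clearC lr |].
  have {}xy : x != y by apply: contraNneq xy => ->.
  have := src_lt_tgt A x; have := src_lt_tgt A y; rewrite /clear /=.
  have := ncA xy; rewrite /clear.
  have [xe|_] := eqVneq x e; have [ye|_] := eqVneq y e; rewrite /= ?leqnn ?src0 -?/k.
  - by rewrite xe ye eqxx in xy.
  - by move=> *; apply/implyP=> _; rewrite /conflict; lia.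
  - by move=> *; apply/implyP=> _; rewrite /conflict; lia.
  by move=> /(_ isT isT)/implyP h _ _; apply/implyP=> /h; rewrite /conflict; lia.
have {}xy : x != y by apply: contraNneq xy => ->.
move=> xg yg; have {xg} xg : x != g by apply: contraNneq xg => ->.
have {yg} yg : y != g by apply: contraNneq yg => ->.
wlog xf : x y xy xg yg / x != f.
  move=> wl; have [xf|] := eqVneq x f; last exact: wl.
  by rewrite clearC; apply: wl => //; [rewrite eq_sym | rewrite -xf eq_sym].
have vf := src_lt_tgt B f; have vx := src_lt_tgt B x; have vy := src_lt_tgt B y.
have [yf|yf] := eqVneq y f.
  apply/implyP=> /= /eqP ux; rewrite yf eqxx (negbTE xf) /=.
  have := ncf xf xg; rewrite ux yf => /(_ erefl).
  have -> : (place B (tgt B f) <= k) = false by rewrite leqNgt vf.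
  rewrite /conflict /N; move: vf vx; rewrite -/k.
  case: (leqP (place B (src B x)) k); case: (leqP (place B (tgt B x)) k); lia.
apply/implyP=> /= ux; have := ncB xy xf yf xg yg; rewrite /clear ux /= (negbTE xf) (negbTE yf) /=.
rewrite /conflict; case: (leqP (place B (src B x)) k); case: (leqP (place B (tgt B x)) k);
  case: (leqP (place B (src B y)) k); case: (leqP (place B (tgt B y)) k); lia.
Qed.

Lemma sum_outer : g != f -> outer B g -> outer sum_arcs (inr g).
Proof.
move=> /negbTE gf [upg src0 top]; have [_ _ topA] := outer_e; split=> //=; rewrite gf /= ?src0 //.
have vf := src_lt_tgt B f; have tf := top (tgt B f); rewrite -/k in vf.
have -> : (place B (tgt B g) <= k) = false by lia.
case=> [w|w] /=; first by have := topA w; rewrite /N; lia.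
by have := top w; case: (leqP (place B w) k); lia.
Qed.

End TwoSum.

(** * Which numbers of cycles are realized *)

Section ListGraph.
Variables (m : nat) (s : seq link) (u : seq bool).
Hypothesis vs : valid m s.
Local Notation link_ k := (nth (0, 0) s k).

Lemma valid_nth (k : 'I_(size s)) : (link_ k).1 < (link_ k).2 < m.
Proof. by have /andP[/all_nthP h _] := vs; apply: h. Qed.

Definition list_src (k : 'I_(size s)) : 'I_m :=
  Ordinal (let lt := andP (valid_nth k) in ltn_trans lt.1 lt.2).
Definition list_tgt (k : 'I_(size s)) : 'I_m := Ordinal (andP (valid_nth k)).2.

Definition list_ends k : {set 'I_m} := [set list_src k; list_tgt k].

Lemma card_list_ends k : #|list_ends k| = 2.
Proof.
rewrite cards2 -val_eqE /=; have /andP[lt _] := valid_nth k.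
by rewrite ltn_eqF.
Qed.

Definition list_graph : mgraph := MGraph card_list_ends.

Lemma list_graph_coded : coded list_graph m s.
Proof.
refine (@Coded list_graph m s (fun w : 'I_m => val w) (fun k : 'I_(size s) => val k) _ _ _ _ _ _ _).
- exact: val_inj.
- by move=> w; apply: ltn_ord.
- exact: card_ord.
- exact: val_inj.
- by move=> k; apply: ltn_ord.
- exact: card_ord.
by move=> k w; rewrite /= !inE -!val_eqE.
Defined.

Lemma list_src_lt_tgt k : val (list_src k) < val (list_tgt k).
Proof. by have /andP[] := valid_nth k. Qed.

Definition list_arcs : arcs list_graph :=
  @Arcs list_graph list_src list_tgt (fun w : 'I_m => val w) (fun k : 'I_(size s) => nth true u k)
    val_inj list_src_lt_tgt (fun=> erefl).

Definition clear_links k l :=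
  (nth true u k == nth true u l) ==>
  ~~ conflict (link_ k).1 (link_ k).2 (link_ l).1 (link_ l).2.

Definition outer_link k := [&& nth true u k, (link_ k).1 == 0 & (link_ k).2 == m.-1].

Lemma outer_list_arcs (k : 'I_(size s)) : outer_link k -> outer list_arcs k.
Proof.
case/and3P=> uk /eqP src0 /eqP tgtE; split=> //= w; rewrite tgtE.
by have := ltn_ord w; case: (m) w.
Qed.

Lemma all_pairsP (P : nat -> nat -> bool) n :
  all (fun k => all (P k) (iota 0 n)) (iota 0 n) -> forall k l, k < n -> l < n -> P k l.
Proof.
move=> /allP h k l kn ln; have /allP h' : all (P k) (iota 0 n) by apply: h; rewrite mem_iota.
by apply: h'; rewrite mem_iota.
Qed.

Definition sound_links :=
  all (fun v => count (meets v) s == 3) (iota 0 m) &&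
  (let cs := circuit_masks m s in let ks := iota 0 (size s) in
   all (fun k => all (fun l => has (fun b => nth false b k && nth false b l) cs) ks) ks).

Lemma list_graph_cubic : sound_links -> cubic list_graph.
Proof. by case/andP=> d3 _; apply: (coded_cubic list_graph_coded). Qed.

Lemma list_graph_linked : sound_links -> linked (cycle_space list_graph) [set: edge list_graph].
Proof. by case/andP=> _; apply: (coded_linked list_graph_coded vs). Qed.

End ListGraph.

(** Reached by some drawn graph with outer edge [e]: [a] circuits avoid [e] and [p]
pass through it. *)
Definition attained (a p : nat) := exists G (A : arcs G) e,
  [/\ cubic G, linked (cycle_space G) [set: edge G], noncrossing A e, outer A e &
      #|[set C | circuit (cycle_space G) C && (e \notin C)]| = a /\
      #|[set C | circuit (cycle_space G) C && (e \in C)]| = p].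

Lemma attained_ncycles a p : attained a p -> exists G (A : arcs G) e,
  [/\ inseparable G, cubic G, noncrossing A e, outer A e & ncycles G = a + p].
Proof.
case=> G [A [e [cG lG ncA oA [cardA cardP]]]]; exists G, A, e; split=> //.
  by apply: linked_inseparable => //; apply/card_gt0P; exists (src A e).
rewrite ncycles_circuits // -cardA -cardP.
rewrite -(cardsID [set C : {set edge G} | e \in C] [set C | circuit (cycle_space G) C]) addnC.
by congr (_ + _); apply: eq_card => C; rewrite !inE // andbC.
Qed.

(** Link 0 is the outer edge. *)
Definition base_check m s u :=
  [&& valid m s, 0 < size s, sound_links m s, outer_link m s u 0 &
    all (fun k => all (fun l => [|| k == 0, l == 0, k == l | clear_links s u k l])
      (iota 0 (size s))) (iota 0 (size s))].

Lemma base_attained m s u : base_check m s u ->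
  attained (count (fun b => ~~ nth false b 0) (circuit_masks m s))
           (count (nth false ^~ 0) (circuit_masks m s)).
Proof.
case/and5P=> vs s0 sound out /all_pairsP nc; pose e : 'I_(size s) := Ordinal s0.
exists (list_graph vs), (list_arcs u vs), e; split.
- exact: list_graph_cubic.
- exact: list_graph_linked.
- move=> k l kl ke le; have := nc k l (ltn_ord _) (ltn_ord _).
  by rewrite -!val_eqE /= in kl ke le *; rewrite (negbTE kl) (negbTE ke) (negbTE le).
- exact: outer_list_arcs.
have count0 := @card_circuits _ _ _ (list_graph_coded vs) vs.
split; [apply: (count0 (fun C => e \notin C)) | apply: (count0 (fun C => e \in C))];
  by move=> b _; rewrite inE.
Qed.

(** The condition on the graph [H] of a two-sum: the edge [f] is cut and link 0 is the
new outer edge. *)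
Definition gadget_check m s u f :=
  let ks := iota 0 (size s) in
  [&& valid m s, 0 < f < size s, sound_links m s, outer_link m s u 0,
    all (fun k => all (fun l => [|| k == 0, l == 0, k == f, l == f, k == l | clear_links s u k l]) ks) ks &
    all (fun k => [|| k == 0, k == f | (nth true u k == nth true u f) ==>
       ~~ conflict (nth (0, 0) s k).1.*2 (nth (0, 0) s k).2.*2
            (nth (0, 0) s f).1.*2.+1 (nth (0, 0) s f).2.*2]) ks].

(** The number of circuits with prescribed memberships of [f] and of link 0. *)
Definition tally m s (f : nat) (x y : bool) :=
  count (fun b => (nth false b f == x) && (nth false b 0 == y)) (circuit_masks m s).

Lemma gadget_attained m s u f a p : gadget_check m s u f -> attained a p ->
  attained (a + tally m s f false false + p * tally m s f true false)
           (tally m s f false true + p * tally m s f true true).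
Proof.
case/and5P=> vs /andP[f0 fs] sound out /andP[/all_pairsP nc /allP ncf].
case=> G [A [e [cG lG ncA oA [cardA cardP]]]].
pose g' : 'I_(size s) := Ordinal (ltn_trans f0 fs); pose f' : 'I_(size s) := Ordinal fs.
have gf : g' != f' by rewrite -val_eqE /= ltn_eqF.
pose B := list_arcs u vs.
exists (two_sum A B e f'), (sum_arcs B f' oA), (inr g').
split.
- by apply: cubic_two_sum => //; apply: list_graph_cubic.
- by apply: linked_two_sum => //; apply: list_graph_linked.
- apply: sum_noncrossing => // [k l kl kf lf kg lg|k kf kg /eqP uk].
    have := nc k l (ltn_ord _) (ltn_ord _); rewrite -!val_eqE /= in kl kf lf kg lg *.
    by rewrite (negbTE kl) (negbTE kf) (negbTE kg) (negbTE lf) (negbTE lg).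
  have /ncf : val k \in iota 0 (size s) by rewrite mem_iota ltn_ord.
  rewrite -!val_eqE /= in kf kg *; rewrite (negbTE kf) (negbTE kg) /= => /implyP; apply.
  exact: uk.
- by apply: sum_outer => //; apply: outer_list_arcs.
have tallyE x y : #|[set D | circuit (cycle_space (list_graph vs)) D &&
      (((f' \in D) == x) && ((g' \in D) == y))]| = tally m s f x y.
  apply: (@card_circuits _ _ _ (list_graph_coded vs) vs
    (fun D => ((f' \in D) == x) && ((g' \in D) == y))).
  by move=> b _; rewrite !inE.
have tallyF y : #|[set D | circuit (cycle_space (list_graph vs)) D &&
      ((f' \notin D) && ((g' \in D) == y))]| = tally m s f false y.
  by rewrite -tallyE; apply: eq_card => D; rewrite !inE eqbF_neg.
have tallyT y : #|[set D | circuit (cycle_space (list_graph vs)) D &&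
      ((f' \in D) && ((g' \in D) == y))]| = tally m s f true y.
  by rewrite -tallyE; apply: eq_card => D; rewrite !inE eqb_id.
split.
  have -> : [set C | circuit (cycle_space (two_sum A B e f')) C && (inr g' \notin C)] =
    [set C | circuit (cycle_space (two_sum A B e f')) C && ((g' \in rpart C) == false)].
    by apply/setP=> C; rewrite !inE eqbF_neg.
  rewrite (@card_circuits_two_sum _ _ A B e f' (fun D => (g' \in D) == false)) tallyF tallyT in_set0 eqxx.
  by rewrite mul1n cardA cardP.
have -> : [set C | circuit (cycle_space (two_sum A B e f')) C && (inr g' \in C)] =
    [set C | circuit (cycle_space (two_sum A B e f')) C && ((g' \in rpart C) == true)].
  by apply/setP=> C; rewrite !inE eqb_id.
rewrite (@card_circuits_two_sum _ _ A B e f' (fun D => (g' \in D) == true)) tallyF tallyT in_set0.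
by rewrite mul0n add0n cardP.
Qed.

(** The gadget is a triple edge: the old graph, with [e] cut, is bridged by a new edge
parallel to it. *)
Lemma attained_rung a p : attained a p -> attained (a + p) p.+1.
Proof.
pose s := [:: (0, 1); (0, 1); (0, 1)].
have ok : gadget_check 2 s [:: true; true; false] 1 by vm_compute.
move=> /(gadget_attained ok).
have -> : tally 2 s 1 false false = 0 by vm_compute.
have -> : tally 2 s 1 true false = 1 by vm_compute.
have -> : tally 2 s 1 false true = 1 by vm_compute.
have -> : tally 2 s 1 true true = 1 by vm_compute.
by rewrite !muln1 addn0 add1n.
Qed.

(** As before, but the bridge is a net with 4 circuits of its own and 6 paths from end
to end: a digon followed by a ladder with three rungs. *)
Lemma attained_net_rung a p : attained a p -> attained (a + 4 + p * 6) (6 + p).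
Proof.
pose s := [:: (0, 7); (0, 7); (0, 1); (1, 2); (1, 2); (2, 3); (3, 4); (3, 6);
              (4, 5); (4, 5); (5, 6); (6, 7)].
pose u := [:: true; false; true; true; false; true; true; true; true; false; true; true].
have ok : gadget_check 8 s u 1 by vm_compute.
move=> /(gadget_attained ok).
have -> : tally 8 s 1 false false = 4 by vm_compute.
have -> : tally 8 s 1 true false = 6 by vm_compute.
have -> : tally 8 s 1 false true = 6 by vm_compute.
have -> : tally 8 s 1 true true = 1 by vm_compute.
by rewrite muln1.
Qed.

(** The Hamiltonian path [0, 1, ..., m-1], closed by the outer edge from above, with
chords above and below.  Every graph of the table has this form. *)
Definition chain m (above below : seq link) : seq (link * bool) :=
  ((0, m.-1), true) ::
  sort (fun x y => x.1.1 <= y.1.1)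
    ([seq ((i, i.+1), true) | i <- iota 0 m.-1] ++
     [seq (x, true) | x <- above] ++ [seq (x, false) | x <- below]).

(** Number of vertices, chords above, chords below, deficit and number of circuits
through the outer edge. *)
Definition row := (nat * seq link * seq link * (nat * nat))%type.
Implicit Types (r : row).
Definition row_size r := r.1.1.1.
Definition row_above r := r.1.1.2.
Definition row_below r := r.1.2.
(** The deficit is [C(p, 2) - a]; it vanishes for ladders, where [p] parallel rungs give
one circuit for each pair. *)
Definition deficit r := r.2.1.
Definition row_through r := r.2.2.

Definition row_check r :=
  let l := chain (row_size r) (row_above r) (row_below r) in
  let cs := circuit_masks (row_size r) (unzip1 l) in
  [&& base_check (row_size r) (unzip1 l) (unzip2 l),
      count (fun b => ~~ nth false b 0) cs + deficit r == 'C(row_through r, 2) &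
      count (nth false ^~ 0) cs == row_through r].

(** The starts with deficits 0, 34, 24, 3, 4, 38, 61, 18, 30, 9, 21 represent the residues
0, 1, ..., 10 modulo 11 and serve all large numbers; the others are there for particular
small ones. *)
Definition rows : seq row := [::
  (2, [::], [:: (0, 1)], (0, 2));
  (4, [::], [:: (0, 1); (2, 3)], (4, 4));
  (4, [:: (0, 2)], [:: (1, 3)], (3, 4));
  (6, [:: (0, 4)], [:: (1, 2); (3, 5)], (9, 6));
  (6, [::], [:: (0, 1); (2, 3); (4, 5)], (25, 8));
  (6, [:: (0, 2)], [:: (1, 3); (4, 5)], (24, 8));
  (6, [:: (0, 2); (3, 5)], [:: (1, 4)], (22, 8));
  (8, [:: (1, 4); (0, 5)], [:: (2, 3); (6, 7)], (21, 8));
  (8, [:: (1, 4); (0, 6)], [:: (2, 3); (5, 7)], (18, 8));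
  (8, [:: (0, 3); (4, 7)], [:: (1, 2); (5, 6)], (30, 9));
  (8, [:: (0, 5)], [:: (1, 2); (3, 4); (6, 7)], (38, 10));
  (8, [:: (1, 3); (0, 5)], [:: (2, 4); (6, 7)], (37, 10));
  (8, [:: (0, 6)], [:: (1, 2); (3, 4); (5, 7)], (34, 10));
  (8, [:: (0, 3)], [:: (1, 2); (4, 5); (6, 7)], (61, 12));
  (8, [:: (0, 4); (5, 7)], [:: (1, 2); (3, 6)], (56, 12));
  (8, [:: (0, 2); (5, 7)], [:: (3, 4); (1, 6)], (55, 12));
  (8, [:: (2, 4); (1, 5); (0, 6)], [:: (3, 7)], (52, 12));
  (8, [:: (1, 3); (0, 4)], [:: (2, 5); (6, 7)], (83, 14));
  (8, [:: (1, 3); (0, 4); (5, 7)], [:: (2, 6)], (79, 14));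
  (8, [:: (0, 2)], [:: (1, 3); (4, 5); (6, 7)], (115, 16));
  (8, [:: (0, 2); (3, 6)], [:: (1, 4); (5, 7)], (110, 16));
  (10, [:: (2, 4); (1, 5); (0, 6)], [:: (7, 8); (3, 9)], (97, 16));
  (10, [:: (2, 5); (1, 7); (0, 8)], [:: (4, 6); (3, 9)], (164, 20));
  (10, [:: (1, 3); (0, 4); (6, 8); (5, 9)], [:: (2, 7)], (278, 25))].

Lemma rows_check : all row_check rows.
Proof. by vm_compute. Qed.

Lemma row_attained r : row_check r ->
  exists2 a, attained a (row_through r) & a + deficit r = 'C(row_through r, 2).
Proof. by case/and3P=> /base_attained att /eqP aE /eqP pE; rewrite pE in att; eexists; first exact: att. Qed.

(** The net rung adds [6p + 4] to [a] and 6 to [p], and [C(p + 6, 2) = C(p, 2) + 6p + 15],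
whence the deficit 11. *)
Lemma attained_family a0 d p0 t k : attained a0 p0 -> a0 + d = 'C(p0, 2) ->
  exists2 a, attained a (p0 + 6 * t + k) & a + (d + 11 * t) = 'C(p0 + 6 * t + k, 2).
Proof.
move=> base dE; elim: k => [|k [a att aE]].
  elim: t => [|t [a att aE]]; first by exists a0; rewrite !muln0 !addn0.
  exists (a + 4 + (p0 + 6 * t) * 6).
    have := attained_net_rung att; rewrite addn0.
    by rewrite (_ : 6 + (p0 + 6 * t) = p0 + 6 * t.+1 + 0) //; lia.
  rewrite !addn0 in aE *.
  have -> : p0 + 6 * t.+1 = (p0 + 6 * t).+4.+2 by lia.
  by rewrite !binS !bin1 !bin0 -aE; lia.
exists (a + (p0 + 6 * t + k)); first by rewrite addnS; apply: attained_rung.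
by rewrite addnS binS bin1 -aE; lia.
Qed.

(** From the start [r] one reaches [p] circuits through the outer edge with deficit
[D]. *)
Definition covers p D r :=
  [&& deficit r <= D, 11 %| D - deficit r &
      row_through r + 6 * ((D - deficit r) %/ 11) <= p].

Definition cover p D := has (covers p D) rows.

Definition realized n := exists a p, attained a p /\ a + p = n.

Lemma cover_realized n p D : cover p D -> n + D = 'C(p.+1, 2) -> realized n.
Proof.
rewrite /cover => /hasP[r /(allP rows_check) ok /and3P[dD /dvdnP[t tE]]].
rewrite tE mulnK // => le nE.
have [a0 att0 aE0] := row_attained ok.
have [a att aE] := attained_family t (p - (row_through r + 6 * t)) att0 aE0.
rewrite subnKC // in att aE; exists a, p; split=> //.
by move: nE; rewrite binS bin1 -aE; lia.
Qed.

(** Passing from [p] to [p.+1] with the same number of circuits in all raises the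
deficit needed by [p.+1]. *)
Fixpoint search k p D :=
  if cover p D then true else if k is k'.+1 then search k' p.+1 (D + p.+1) else false.

Lemma search_realized k n p D : search k p D -> n + D = 'C(p.+1, 2) -> realized n.
Proof.
elim: k p D => [|k IH] p D /=; case: ifP => cov // srch nE; try exact: cover_realized cov nE.
by apply: IH srch _; rewrite binS bin1 -nE addnA.
Qed.

(** The pairs [(p, D)] with [C(p + 1, 2) - D] among the eight exceptions. *)
Definition gaps := [:: (1, 0); (2, 1); (3, 2); (3, 1); (4, 2); (4, 1); (5, 2); (6, 5)].

(** A deficit that fits is found after at most 15 increases of [p]. *)
Lemma search_small :
  all (fun p => all (fun D => ((p, D) \in gaps) || search 15 p D) (iota 0 p)) (iota 0 79).
Proof. by vm_compute. Qed.

Lemma triangular_window n : 0 < n -> exists p D, D < p /\ n + D = 'C(p.+1, 2).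
Proof.
case: n => // n _; elim: n => [|n [p [[|D] [Dp nE]]]]; first by exists 1, 0.
  by exists p.+1, p; split=> //; rewrite binS bin1 -nE; lia.
by exists p, D; split; [apply: ltnW | rewrite -nE; lia].
Qed.

(** The starts with deficit at most 61 represent all residues modulo 11.  Increasing the
deficit by 11 costs 6 in [p], so the worst cost for deficits below [61 + p] is
[(386 + 6p) / 11], which is at most [p] from [p = 78] on. *)
Lemma cover_large p D : 78 <= p -> 61 <= D < 61 + p -> cover p D.
Proof.
move=> p78 /andP[D61 Dp].
have residues : all (fun i => has (fun r => [&& deficit r %% 11 == i, deficit r <= 61 &
    11 * row_through r <= 6 * deficit r + 26]) rows) (iota 0 11) by vm_compute.
have /(allP residues)/hasP[r rr /and3P[/eqP dD d61 rp]] : D %% 11 \in iota 0 11.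
  by rewrite mem_iota ltn_mod.
apply/hasP; exists r => //; rewrite /covers; have dD' := leq_trans d61 D61; rewrite dD' /=.
have div : 11 %| D - deficit r by rewrite -eqn_mod_dvd // dD.
rewrite div /=; move: div => /dvdnP[t tE]; rewrite tE mulnK //; lia.
Qed.

Lemma all_realized n : 0 < n -> n \notin [:: 1; 2; 4; 5; 8; 9; 13; 16] -> realized n.
Proof.
move=> n0 nbad; have [p [D [Dp nE]]] := triangular_window n0.
have [p79|p79] := ltnP p 79.
  have /allP/(_ p) := search_small; rewrite mem_iota p79 => /(_ isT)/allP/(_ D).
  rewrite mem_iota Dp => /(_ isT)/orP[|/search_realized]; last exact.
  move=> gap; have nE' : n = 'C(p.+1, 2) - D by rewrite -nE addnK.
  rewrite {}nE' in nbad; move: gap nbad; clear.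
  by rewrite !inE => /or4P[|||/or4P[|||/orP[|]]] /eqP[-> ->].
(* the window of n + 61 gives a deficit between 61 and 61 + p' *)
have [|p' [D' [Dp' nE']]] := @triangular_window (n + 61); first by rewrite addn_gt0 n0.
have pp' : p <= p'.
  rewrite leqNgt; apply/negP=> lt; have := leq_bin2l 2 lt.
  by move: nE nE'; rewrite [X in _ = X -> _]binS bin1; lia.
by apply: (cover_realized (p := p') (D := 61 + D')); [apply: cover_large; lia | lia].
Qed.

(** * Drawings by parabolic arcs *)

From mathcomp Require Import all_order all_algebra.
From mathcomp Require Import all_classical all_reals all_analysis.
From mathcomp Require Import ring lra.
Import Order.TTheory GRing.Theory Num.Theory numFieldNormedType.Exports.

Lemma overlap_nested a b c d : ~~ conflict a b c d -> c < b -> a < d ->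
  [/\ a <= c, d <= b & (a < c) || (d < b)] \/ [/\ c <= a, b <= d & (c < a) || (b < d)].
Proof.
rewrite /conflict => nc cb ad; have [lt|lt|eq] := ltngtP a c.
- by left; split; lia.
- by right; split; lia.
have [le|lt] := leqP d b; [left|right]; split; lia.
Qed.

Section Drawing.
Local Open Scope ring_scope.
Variables (R : realType) (G : mgraph) (A : arcs G).
Variable e0 : edge G.
Hypotheses (outer_e0 : outer A e0) (ncA : noncrossing A e0).

(** Both factors grow when the interval does. *)
Lemma parabola_lt (a b c d x : R) : c < x -> x < d -> a <= c -> d <= b ->
  (a < c) || (d < b) -> (x - c) * (d - x) < (x - a) * (b - x).
Proof.
move=> cx xd ac db strict; have cx0 : 0 < x - c by rewrite subr_gt0.
have xd0 : 0 < d - x by rewrite subr_gt0.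
case/orP: strict => [lt_ac|lt_db].
  apply: (@lt_le_trans _ _ ((x - a) * (d - x))).
    by rewrite ltr_pM2r // ltrD2l ltrN2.
  by rewrite ler_wpM2l ?lerD2r // subr_ge0 (le_trans ac) // ltW.
apply: (@lt_le_trans _ _ ((x - c) * (b - x))); first by rewrite ltr_pM2l // ltrD2r.
by rewrite ler_wpM2r ?lerD2l ?lerN2 // subr_ge0 (le_trans (ltW xd)).
Qed.

Let l e : R := (place A (src A e))%:R.
Let r e : R := (place A (tgt A e))%:R.
Let s e : R := if e == e0 then 2 else if up A e then 1 else -1.

Definition point v : R * R := ((place A v)%:R, 0).
(** A parabolic arc over the span of [e], parametrized by the relative abscissa. *)
Definition arch e (t : R) : R * R :=
  (l e + t * (r e - l e), s e * (t * (1 - t) * (r e - l e) ^+ 2)).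

Let lr e : l e < r e.
Proof. by rewrite ltr_nat src_lt_tgt. Qed.

Lemma arch_continuous e : continuous (arch e).
Proof.
have cx : continuous (fun t : R => l e + t * (r e - l e)).
  move=> t; apply: cvgD; first exact: cvg_cst.
  by apply: cvgM; [exact: cvg_id | exact: cvg_cst].
have cy : continuous (fun t : R => s e * (t * (1 - t) * (r e - l e) ^+ 2)).
  move=> t; apply: cvgM; first exact: cvg_cst.
  apply: cvgM; last exact: cvg_cst.
  apply: cvgM; first exact: cvg_id.
  by apply: cvgB; [exact: cvg_cst | exact: cvg_id].
by move=> t; exact: (cvg_pair (cx t) (cy t)).
Qed.

Lemma arch_inj e : injective (arch e).
Proof.
move=> t t' [/addrI eq _]; apply: (mulIf _ eq).
by rewrite subr_eq0 gt_eqF // lr.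
Qed.

Let q e (x : R) := (x - l e) * (r e - x).

Lemma arch_inside e t : 0 < t < 1 ->
  exists x, [/\ l e < x, x < r e & arch e t = (x, s e * q e x)].
Proof.
move=> /andP[t0 t1]; have re := lr e; exists (l e + t * (r e - l e)).
by split; [nra | nra | rewrite /arch /q; congr (_, _ * _); ring].
Qed.

(** The outer edge has amplitude 2, so it lies strictly above even an arc with the same
ends. *)
Lemma arch_below e f x : f != e0 -> e = e0 -> l f < x -> x < r f ->
  s e * q e x <> s f * q f x.
Proof.
move=> ff ee fx xf; have [up0 src0 top] := outer_e0; rewrite ee /s eqxx (negbTE ff).
have L : l e0 <= l f by rewrite ler_nat src0.
have U : r f <= r e0 by rewrite ler_nat top.
have qf : 0 < q f x by rewrite mulr_gt0 // subr_gt0.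
have qe : q f x <= q e0 x.
  apply: ler_pM; rewrite ?subr_ge0 ?lerD2l ?lerN2 ?lerD2r //; exact: ltW.
by case: (up A f); lra.
Qed.

Lemma arch_disjoint e f t t' : e != f -> 0 < t < 1 -> 0 < t' < 1 -> arch e t <> arch f t'.
Proof.
move=> ef /(arch_inside e)[x [xl xr ->]] /(arch_inside f)[y [yl yr ->]] [xy].
rewrite -{}xy in yl yr *.
have [ee|ee] := eqVneq e e0.
  by apply: arch_below; rewrite // -ee eq_sym.
have [ff|ff] := eqVneq f e0; first by move/esym; apply: arch_below.
rewrite /s (negbTE ee) (negbTE ff) => eqy.
have pe : 0 < q e x by rewrite mulr_gt0 // subr_gt0.
have pf : 0 < q f x by rewrite mulr_gt0 // subr_gt0.
have uu : up A e == up A f.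
  by move: eqy; case: (up A e); case: (up A f) => // eqy; exfalso; lra.
have {}eqy : q e x = q f x.
  by move: eqy; rewrite (eqP uu); case: (up A f); lra.
have lt1 : l f < r e by apply: lt_trans yl xr.
have lt2 : l e < r f by apply: lt_trans xl yr.
rewrite !ltr_nat in lt1 lt2.
have := ncA ef ee ff; rewrite /clear uu => /overlap_nested/(_ lt1 lt2)[] [L U strict].
  have := parabola_lt (a := l e) (b := r e) yl yr; rewrite -/(q e x) eqy ltxx !ler_nat !ltr_nat.
  by move=> /(_ L U strict).
have := parabola_lt (a := l f) (b := r f) xl xr; rewrite -/(q f x) -eqy ltxx !ler_nat !ltr_nat.
by move=> /(_ L U strict).
Qed.

Lemma noncrossing_planar : planar R G.
Proof.
exists point, arch; split.
- by move=> u v [/eqP]; rewrite eqr_nat => /eqP/place_inj.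
- move=> e; split; last by move=> t t' _ _; apply: arch_inj.
  by apply: continuous_subspaceT; apply: arch_continuous.
- move=> e; exists (src A e), (tgt A e); split.
  + exact: ends_arc.
  + by rewrite /arch /point !mul0r addr0 mulr0.
  + by rewrite /arch /point mul1r subrr mulr0 mul0r mulr0 addrC subrK.
- move=> e v t /andP[t0 t1] [_ /eqP].
  rewrite mulf_eq0 /s; apply/negP/norP; split.
    by case: (e == e0); case: (up A e); rewrite ?oppr_eq0 ?oner_eq0 ?pnatr_eq0.
  by rewrite gt_eqF // !mulr_gt0 ?exprn_gt0 ?subr_gt0 ?lr.
by move=> e f t t'; apply: arch_disjoint.
Qed.

End Drawing.

Lemma realized_planar (R : realType) n : realized n ->
  exists G : mgraph, [/\ inseparable G, planar R G, cubic G & ncycles G = n].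
Proof.
case=> a [p [/attained_ncycles[G [A [e [iG cG ncA oA cyc]]]] <-]].
by exists G; split=> //; apply: noncrossing_planar oA ncA.
Qed.

Local Open Scope classical_set_scope.
Local Open Scope nat_scope.

Lemma mem_exceptions n :
  [set 1; 2; 4; 5; 8; 9; 13; 16] n <-> n \in [:: 1; 2; 4; 5; 8; 9; 13; 16].
Proof.
rewrite !inE; split.
  by move=> [[[[[[[->|->]|->]|->]|->]|->]|->]|->].
by move=> /or4P[|||/or4P[|||/orP[|]]] /eqP->; do ?[by right | left].
Qed.

Theorem theorem2 (R : realType) :
  [set n : nat | 0 < n /\
     ~ exists G : mgraph, [/\ inseparable G, cubic G & ncycles G = n]]
    = [set 1; 2; 4; 5; 8; 9; 13; 16] /\
  [set n : nat | 0 < n /\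
     ~ exists G : mgraph,
         [/\ inseparable G, planar R G, cubic G & ncycles G = n]]
    = [set 1; 2; 4; 5; 8; 9; 13; 16].
Proof.
have exception n : n \in [:: 1; 2; 4; 5; 8; 9; 13; 16] ->
    0 < n /\ ~ exists G : mgraph, [/\ inseparable G, cubic G & ncycles G = n].
  move=> nE; split; first by move: nE; case: n.
  by case=> G [iG cG cycE]; have := ncycles_neq iG cG; rewrite cycE nE.
have planar_graph n : 0 < n -> n \notin [:: 1; 2; 4; 5; 8; 9; 13; 16] ->
    exists G : mgraph, [/\ inseparable G, planar R G, cubic G & ncycles G = n].
  by move=> n0 /(all_realized n0); apply: realized_planar.
split; apply/seteqP; split=> n /=.
- case=> n0 none; apply/mem_exceptions/negPn/negP=> /(planar_graph n n0)[G [? _ ? ?]].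
  by apply: none; exists G.
- by move=> /mem_exceptions; apply: exception.
- case=> n0 none; apply/mem_exceptions/negPn/negP=> /(planar_graph n n0).
  exact: none.
move=> /mem_exceptions/exception[n0 none]; split=> // -[G [? _ ? ?]].
by apply: none; exists G.
Qed.
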